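(* Let $\varphi(s)=c_0s+\sum_{k=1}^{+\infty}c_k k^{-s}=c_0 s+\psi(s)\in\mathcal G_{>0}$. (i) If $c_0=1$, there exists a unique, up to an additive constant, $u\in\mathcal{GH}_{>0}$ with $\mathrm{char}(u)=1$ such that $u\circ\varphi=u+c_1$. Moreover, if there exists $\delta>0$ such that $\varphi(\mathbb C_0)\subset\mathbb C_\delta$, we may choose $u\in\mathcal G_{>0}$. (ii) If $c_0>1$, there exists a unique $u\in\mathcal G_{>0}$ with $\mathrm{char}(u)=1$ such that $u\circ\varphi=c_0u$. In both cases, if $\varphi$ is injective, then $u$ is injective.
   Context: For $\theta\in\mathbb R$, $\mathbb C_\theta=\{s\in\mathbb C:\mathrm{Re}\,s>\theta\}$. $\mathcal D$ is the set of holomorphic functions $f$ defined on some open set $U\subset\mathbb C$ containing a half-plane $\mathbb C_\theta$ such that $f$ equals the sum of a convergent Dirichlet series $\sum_{n\ge1}a_nn^{-s}$ in some (possibly remote) half-plane. The Gordon-Hedenmalm class $\mathcal G$ consists of the maps $\varphi:\mathbb C_{1/2}\to\mathbb C_{1/2}$ of the form $\varphi(s)=c_0s+\psi(s)$, where $c_0$ is a non-negative integer (the characteristic, $\mathrm{char}(\varphi)=c_0$), $\psi\in\mathcal D$ converges uniformly in $\mathbb C_\varepsilon$ for every $\varepsilon>0$, and (a) $\psi(\mathbb C_0)\subset\mathbb C_{1/2}$ if $c_0=0$; (b) $\psi\equiv i\tau$ for some $\tau\in\mathbb R$ or $\psi(\mathbb C_0)\subset\mathbb C_0$ if $c_0\ge1$.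 $\mathcal G_{>0}$ is the set of $\varphi\in\mathcal G$ with positive characteristic $c_0\geq 1$; such a $\varphi$ is regarded as a holomorphic self-map of $\mathbb C_0$. $\mathcal{GH}_{>0}$ is the set of holomorphic functions $u:\mathbb C_0\to\mathbb C$ that can be written $u(s)=d_0s+\theta(s)$ where $d_0$ is a positive integer (the characteristic $\mathrm{char}(u)$) and $\theta$ is a Dirichlet series which converges uniformly on $\mathbb C_\varepsilon$ for all $\varepsilon>0$.
   Formalization: In (i), uniqueness is claimed only when ψ is not a constant iτ with n^{-iτ}=1 for some n≥2 (it fails there: for φ(s)=s, every s+b·n^{-s} is a solution); in that excluded case, injectivity of φ gives an injective solution u, not injectivity of every solution. *)

(* Defs.v *)
From Stdlib Require Import Reals.
From Coquelicot Require Import Coquelicot.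

Open Scope R_scope.

Definition half_plane (theta : R) (s : C) : Prop := theta < Re s.

Definition maps_into (A B : C -> Prop) (f : C -> C) : Prop :=
  forall s : C, A s -> B (f s).

Definition injective_on (A : C -> Prop) (f : C -> C) : Prop :=
  forall s t : C, A s -> A t -> f s = f t -> s = t.

(* Functions are total on [C]; only their values on the domain [U] matter. *)
Definition holomorphic_on (U : C -> Prop) (f : C -> C) : Prop :=
  forall s : C, U s -> @ex_derive C_AbsRing C_NormedModule f s.

Definition Cexp (z : C) : C :=
  (exp (Re z) * cos (Im z), exp (Re z) * sin (Im z)).

(* n^{-s}, for n >= 1. *)
Definition npow_opp (n : nat) (s : C) : C :=
  Cexp (- (s * RtoC (ln (INR n))))%C.

Definition dirichlet_term (a : nat -> C) (s : C) (n : nat) : C :=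
  (a n * npow_opp n s)%C.

(* Dirichlet series start at n = 1: [a 0] is never used, whereas [is_series]
   sums from index 0, whence the shift. *)
Definition is_dirichlet_series (a : nat -> C) (s l : C) : Prop :=
  @is_series C_AbsRing C_NormedModule (fun n => dirichlet_term a s (S n)) l.

Definition dirichlet_partial (a : nat -> C) (N : nat) (s : C) : C :=
  @sum_n_m C_AbelianMonoid (dirichlet_term a s) 1 N.

Definition dirichlet_cvg_unif (a : nat -> C) (A : C -> Prop) (f : C -> C)
  : Prop :=
  forall e : R, 0 < e ->
  exists N0 : nat, forall N : nat, (N0 <= N)%nat ->
  forall s : C, A s -> Cmod (dirichlet_partial a N s - f s)%C < e.

(* f, with domain U, is in the class D, with Dirichlet coefficients a. *)
Definition class_D (U : C -> Prop) (a : nat -> C) (f : C -> C) : Prop :=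
  @open C_UniformSpace U /\
  (exists theta : R, forall s : C, half_plane theta s -> U s) /\
  holomorphic_on U f /\
  (exists sigma : R, forall s : C,
     half_plane sigma s -> is_dirichlet_series a s (f s)).

(* phi(s) = c0 s + psi(s) belongs to the Gordon-Hedenmalm class, where c is the
   sequence of Dirichlet coefficients of psi.  Uniform convergence on every
   C_eps makes psi, hence phi, defined on C_0; phi is identified with this
   extension, so the decomposition is required on C_0 and not only on
   C_{1/2}. *)
Definition gordon_hedenmalm (c0 : nat) (c : nat -> C) (psi phi : C -> C)
  : Prop :=
  maps_into (half_plane (1/2)) (half_plane (1/2)) phi /\
  (forall s : C, half_plane 0 s -> phi s = (RtoC (INR c0) * s + psi s)%C) /\
  class_D (half_plane 0) c psi /\
  (forall eps : R, 0 < eps -> dirichlet_cvg_unif c (half_plane eps) psi) /\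
  (c0 = 0%nat -> maps_into (half_plane 0) (half_plane (1/2)) psi) /\
  ((1 <= c0)%nat ->
     (exists tau : R, forall s : C, half_plane 0 s -> psi s = (Ci * RtoC tau)%C)
     \/ maps_into (half_plane 0) (half_plane 0) psi).

(* u is in G_{>0}, with char(u) = d0. *)
Definition class_G_pos (d0 : nat) (u : C -> C) : Prop :=
  (1 <= d0)%nat /\
  exists (a : nat -> C) (theta : C -> C), gordon_hedenmalm d0 a theta u.

(* u is in GH_{>0}, with char(u) = d0. *)
Definition class_GH_pos (d0 : nat) (u : C -> C) : Prop :=
  (1 <= d0)%nat /\
  holomorphic_on (half_plane 0) u /\
  exists (a : nat -> C) (theta : C -> C),
    (forall s : C, half_plane 0 s -> u s = (RtoC (INR d0) * s + theta s)%C) /\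
    (forall eps : R, 0 < eps -> dirichlet_cvg_unif a (half_plane eps) theta).

(* u o phi = u + b on C_0 *)
Definition abel_equation (phi : C -> C) (b : C) (u : C -> C) : Prop :=
  forall s : C, half_plane 0 s -> u (phi s) = (u s + b)%C.

(* u o phi = lambda u on C_0 *)
Definition schroeder_equation (phi : C -> C) (lambda : C) (u : C -> C) : Prop :=
  forall s : C, half_plane 0 s -> u (phi s) = (lambda * u s)%C.

(* psi is a constant i tau with n^{-i tau} = 1 for some n >= 2.  When
   phi(s) = s + psi(s), the function n^{-s} is then invariant under phi, so
   that s and s + b n^{-s} (b any complex number) solve the same Abel equation:
   uniqueness up to a constant fails exactly in this case. *)
Definition resonant_translation (psi : C -> C) : Prop :=
  exists (tau : R) (n : nat), (2 <= n)%nat /\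
    npow_opp n (Ci * RtoC tau)%C = RtoC 1 /\
    forall s : C, half_plane 0 s -> psi s = (Ci * RtoC tau)%C.

(* Main.v *)
Require Import Defs.
From Stdlib Require Import Reals Lra Lia Psatz IndefiniteDescription.
From Coquelicot Require Import Coquelicot.

Open Scope R_scope.

(** Koenigs' method gives the linearizing map as the limit of [phi^n(s) - n c_1] when
    [c0 = 1], and of [phi^n(s) / c0^n] when [c0 > 1]. Three points need an argument: that
    the iterates go to the right fast enough, uniformly on half-planes; that the limit
    is again a Dirichlet series, uniformly convergent on each [Re s > eps]; and that it is
    holomorphic, and injective when [phi] is.

    Escape. For [c0 > 1] it is clear that [Re phi^n(s) >= c0^n Re s]. For [c0 = 1] and [psi]
    not an imaginary constant, [Re c_1 > 0], since otherwise the first nonconstant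
    term of [psi] would make [Re psi] negative somewhere far to the right
    ([constant_coef_positive]). Harnack's inequality then bounds [Re psi] below by a
    positive constant on [Re s > eps] ([harnack_dirichlet]). For Dirichlet polynomials it
    follows from summing twice by parts: [n^(-d)] is convex as a function of [ln n],
    so that a shift by [d] is a positive combination of Riesz means, which preserve
    positivity because they are averages against Fejer kernels ([fejer_mean_le]).

    Dirichlet series. Uniform limits of Dirichlet polynomials on all half-planes
    [Re s > eps] are stable under products, hence under the exponential, hence under
    composition with [phi], as [n^(-phi) = (n^(-s))^c0 exp (- psi ln n)]
    ([uapprox_comp]). All the approximants of the linearizing map are of this kind. That
    such a limit is the sum of its own Dirichlet series, with uniform convergence of
    the partial sums ([uapprox_cvg]), is a form of Bohr's theorem. It rests on the
    estimate of [bohr_partial_sums]: the [N]-th partial sum operator costs a factor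
    [O(log N)] on a vertical line, because a trapezoid with a slope of width about [1/N]
    is a sum of [O(log N)] triangles, each the transform of a modulated Fejer kernel;
    Abel summation absorbs the logarithm after a shift to the right.

    Regularity. Far to the right the series converges absolutely, and there
    [u(s) = s + theta(s)] is holomorphic and injective, [theta] having a small Lipschitz
    constant. Elsewhere the functional equation expresses [u] as an affine function of
    [u(phi^n(s))], with [phi^n(s)] as far to the right as wanted. Uniqueness
    follows from the behaviour along an orbit of the difference of two solutions, which
    tends to a constant if [c0 = 1] and remains bounded if [c0 > 1]; for an imaginary
    translation one compares coefficients instead. *)

(** * Finite sums *)

Definition Csum (f : nat -> C) (N : nat) : C := @sum_n_m C_AbelianMonoid f 1 N.
Definition Rsum (f : nat -> R) (N : nat) : R := @sum_n_m R_AbelianMonoid f 1 N.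

Lemma Csum_0 f : Csum f 0 = RtoC 0.
Proof. unfold Csum; rewrite sum_n_m_zero; [reflexivity | lia]. Qed.

Lemma Csum_S f N : Csum f (S N) = (Csum f N + f (S N))%C.
Proof. unfold Csum; rewrite sum_n_Sm; [reflexivity | lia]. Qed.

Lemma Rsum_0 f : Rsum f 0 = 0.
Proof. unfold Rsum; rewrite sum_n_m_zero; [reflexivity | lia]. Qed.

Lemma Rsum_S f N : Rsum f (S N) = Rsum f N + f (S N).
Proof. unfold Rsum; rewrite sum_n_Sm; [reflexivity | lia]. Qed.

Lemma Csum_ext f g N :
  (forall n, (1 <= n <= N)%nat -> f n = g n) -> Csum f N = Csum g N.
Proof.
  induction N as [|N IH]; intros H; [now rewrite !Csum_0|].
  rewrite !Csum_S, IH, H by (try lia; intros; apply H; lia); reflexivity.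
Qed.

Lemma Rsum_ext f g N :
  (forall n, (1 <= n <= N)%nat -> f n = g n) -> Rsum f N = Rsum g N.
Proof.
  induction N as [|N IH]; intros H; [now rewrite !Rsum_0|].
  rewrite !Rsum_S, IH, H by (try lia; intros; apply H; lia); reflexivity.
Qed.

Lemma Csum_plus f g N : Csum (fun n => f n + g n)%C N = (Csum f N + Csum g N)%C.
Proof.
  induction N as [|N IH]; rewrite ?Csum_0, ?Csum_S, ?IH; ring.
Qed.

Lemma Rsum_plus f g N : Rsum (fun n => f n + g n) N = Rsum f N + Rsum g N.
Proof.
  induction N as [|N IH]; rewrite ?Rsum_0, ?Rsum_S, ?IH; ring.
Qed.

Lemma Csum_scal k f N : Csum (fun n => k * f n)%C N = (k * Csum f N)%C.
Proof.
  induction N as [|N IH]; rewrite ?Csum_0, ?Csum_S, ?IH; ring.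
Qed.

Lemma Rsum_scal k f N : Rsum (fun n => k * f n) N = k * Rsum f N.
Proof.
  induction N as [|N IH]; rewrite ?Rsum_0, ?Rsum_S, ?IH; ring.
Qed.

Lemma Re_Csum f N : Re (Csum f N) = Rsum (fun n => Re (f n)) N.
Proof.
  induction N as [|N IH]; [now rewrite Csum_0, Rsum_0|].
  now rewrite Csum_S, Rsum_S, re_plus, IH.
Qed.

Lemma Rsum_nonneg f N :
  (forall n, (1 <= n <= N)%nat -> 0 <= f n) -> 0 <= Rsum f N.
Proof.
  induction N as [|N IH]; intros H; [rewrite Rsum_0; lra|].
  rewrite Rsum_S; apply Rplus_le_le_0_compat; [apply IH; intros|]; apply H; lia.
Qed.

Lemma Cmod_Csum_le f g N :
  (forall n, (1 <= n <= N)%nat -> Cmod (f n) <= g n) ->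
  Cmod (Csum f N) <= Rsum g N.
Proof.
  induction N as [|N IH]; intros H; [rewrite Csum_0, Rsum_0, Cmod_0; lra|].
  rewrite Csum_S, Rsum_S; eapply Rle_trans; [apply Cmod_triangle|].
  apply Rplus_le_compat; [apply IH; intros|]; apply H; lia.
Qed.

Lemma Csum_truncate f K N :
  (K <= N)%nat ->
  Csum (fun n => if (n <=? K)%nat then f n else RtoC 0) N = Csum f K.
Proof.
  intros H; induction N as [|N IH].
  - now replace K with 0%nat by lia; rewrite !Csum_0.
  - rewrite Csum_S; destruct (Nat.eq_dec K (S N)) as [->|Hne].
    + rewrite Csum_S, Nat.leb_refl; f_equal.
      apply Csum_ext; intros n Hn.
      now rewrite (proj2 (Nat.leb_le n (S N))) by lia.
    + rewrite IH by lia.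
      rewrite (proj2 (Nat.leb_gt (S N) K)) by lia; ring.
Qed.

(** * The complex exponential *)

Lemma Cmod_le_Re_Im z : Cmod z <= Rabs (Re z) + Rabs (Im z).
Proof.
  apply Rsqr_incr_0_var;
    [|apply Rplus_le_le_0_compat; apply Rabs_pos].
  rewrite !Rsqr_pow2, Cmod2_alt.
  rewrite <- (pow2_abs (Re z)), <- (pow2_abs (Im z)).
  pose proof (Rabs_pos (Re z)); pose proof (Rabs_pos (Im z)); nra.
Qed.

Lemma Re_le_Cmod z : Re z <= Cmod z.
Proof. eapply Rle_trans; [apply Rle_abs | apply re_le_Cmod]. Qed.

Lemma Re_ge_Cmod z : - Cmod z <= Re z.
Proof.
  pose proof (re_le_Cmod z); pose proof (Rle_abs (- Re z)).
  rewrite Rabs_Ropp in H0; lra.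
Qed.

Lemma Im_le_Cmod z : Rabs (Im z) <= Cmod z.
Proof. eapply Rle_trans; [apply Rmax_r | apply Rmax_Cmod]. Qed.

Lemma Cexp_plus z w : Cexp (z + w)%C = (Cexp z * Cexp w)%C.
Proof.
  unfold Cexp; rewrite re_plus, im_plus, exp_plus, cos_plus, sin_plus.
  unfold Cmult; simpl; f_equal; ring.
Qed.

Lemma Cmod_Cexp z : Cmod (Cexp z) = exp (Re z).
Proof.
  unfold Cexp, Cmod; simpl.
  replace (_ + _) with (Rsqr (exp (Re z))).
  - apply sqrt_Rsqr, Rlt_le, exp_pos.
  - pose proof (sin2_cos2 (Im z)) as H; unfold Rsqr in *.
    transitivity (exp (Re z) * exp (Re z)
       * (sin (Im z) * sin (Im z) + cos (Im z) * cos (Im z))); [rewrite H|]; ring.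
Qed.

Lemma Cexp_0 : Cexp (RtoC 0) = RtoC 1.
Proof. unfold Cexp; simpl; rewrite exp_0, cos_0, sin_0; unfold RtoC; f_equal; ring. Qed.

Lemma exp_sub_1_abs_le x : Rabs (exp x - 1) <= Rabs x * exp (Rabs x).
Proof.
  pose proof (exp_ineq1_le x) as H1; pose proof (exp_ineq1_le (- x)) as H2.
  assert (He : exp x * exp (- x) = 1) by (rewrite <- exp_plus, Rplus_opp_r; apply exp_0).
  pose proof (exp_pos x); pose proof (exp_pos (- x)).
  destruct (Rle_or_lt 0 x).
  - rewrite !(Rabs_pos_eq x) by lra; rewrite Rabs_pos_eq by lra; nra.
  - rewrite !(Rabs_left x) by lra.
    assert (exp x <= 1) by (rewrite <- exp_0; left; apply exp_increasing; lra).
    rewrite Rabs_left1 by lra; nra.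
Qed.

Lemma exp_sub_1_abs_le_nonpos x : x <= 0 -> Rabs (exp x - 1) <= Rabs x.
Proof.
  intros Hx; pose proof (exp_ineq1_le x) as H1.
  assert (exp x <= 1).
  { destruct Hx as [Hx | ->]; [|rewrite exp_0; lra].
    rewrite <- exp_0; left; apply exp_increasing; lra. }
  rewrite !Rabs_left1; lra.
Qed.

Lemma exp_taylor_1 x : Rabs (exp x - 1 - x) <= x ^ 2 * exp (Rabs x).
Proof.
  pose proof (exp_ineq1_le x) as H1; pose proof (exp_ineq1_le (- x)) as H2.
  assert (He : exp x * exp (- x) = 1) by (rewrite <- exp_plus, Rplus_opp_r; apply exp_0).
  pose proof (exp_pos x); pose proof (exp_pos (- x)).
  rewrite Rabs_pos_eq by lra.
  assert (exp x - 1 - x <= x * (exp x - 1)) by nra.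
  pose proof (exp_sub_1_abs_le x).
  assert (1 <= exp (Rabs x))
    by (pose proof (exp_ineq1_le (Rabs x)); pose proof (Rabs_pos x); lra).
  replace (x ^ 2) with (Rabs x * Rabs x) by (rewrite <- Rabs_mult; rewrite Rabs_pos_eq; nra).
  eapply Rle_trans; [apply Rle_trans with (1 := H3); apply Rle_abs|].
  rewrite Rabs_mult, Rmult_assoc; apply Rmult_le_compat_l; [apply Rabs_pos | assumption].
Qed.

Lemma one_minus_cos x : 1 - cos x = 2 * (sin (x / 2)) ^ 2.
Proof.
  replace x with (2 * (x / 2)) at 1 by field; rewrite cos_2a_sin; ring.
Qed.

Lemma sin_abs_le x : Rabs (sin x) <= Rabs x.
Proof.
  destruct (Req_dec x 0) as [->|Hx]; [rewrite sin_0; lra|].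
  destruct (MVT_gen sin 0 x cos) as [c [_ Hc]].
  - intros; apply is_derive_Reals, derivable_pt_lim_sin.
  - intros; apply derivable_continuous_pt, derivable_pt_sin.
  - rewrite sin_0, !Rminus_0_r in Hc; rewrite Hc, Rabs_mult.
    assert (Rabs (cos c) <= 1) by (apply Rabs_le, COS_bound).
    pose proof (Rabs_pos x); nra.
Qed.

Lemma cos_sub_1_abs_le x : Rabs (cos x - 1) <= Rabs x.
Proof.
  rewrite Rabs_minus_sym, one_minus_cos, Rabs_mult, (Rabs_pos_eq 2), <- RPow_abs by lra.
  pose proof (sin_abs_le (x / 2)) as H.
  assert (H1 : Rabs (sin (x / 2)) <= 1) by (apply Rabs_le, SIN_bound).
  unfold Rdiv in H at 2; rewrite Rabs_mult, (Rabs_pos_eq (/ 2)) in H by lra.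
  pose proof (Rabs_pos (sin (x/2))); nra.
Qed.

Lemma cos_taylor_1 x : Rabs (cos x - 1) <= x ^ 2.
Proof.
  rewrite Rabs_minus_sym, one_minus_cos, Rabs_mult, (Rabs_pos_eq 2), <- RPow_abs by lra.
  pose proof (sin_abs_le (x / 2)) as H.
  unfold Rdiv in H at 2; rewrite Rabs_mult, (Rabs_pos_eq (/ 2)) in H by lra.
  rewrite <- (pow2_abs x); pose proof (Rabs_pos (sin (x/2))); nra.
Qed.

Lemma sin_taylor_1 x : Rabs (sin x - x) <= x ^ 2.
Proof.
  destruct (MVT_gen (fun x => sin x - x) 0 x (fun x => cos x - 1)) as [c [Hc1 Hc]].
  - intros; auto_derive; [easy | ring].
  - intros; apply derivable_continuous_pt; reg.
  - rewrite sin_0, !Rminus_0_r in Hc; rewrite Hc, Rabs_mult.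
    pose proof (cos_sub_1_abs_le c).
    assert (Rabs c <= Rabs x).
    { unfold Rmin, Rmax in Hc1; destruct (Rle_dec 0 x).
      - rewrite !Rabs_pos_eq by lra; lra.
      - rewrite !Rabs_left1 by lra; lra. }
    rewrite <- (pow2_abs x); pose proof (Rabs_pos x); pose proof (Rabs_pos (cos c - 1)); nra.
Qed.

Lemma exp_le_exp x y : x <= y -> exp x <= exp y.
Proof. intros [H | ->]; [left; now apply exp_increasing | lra]. Qed.

Lemma Cexp_taylor_1 w :
  Cmod (Cexp w - 1 - w)%C <= 3 * Cmod w ^ 2 * exp (Cmod w).
Proof.
  destruct w as [x y]; set (m := Cmod (x, y)).
  assert (Hx : Rabs x <= m) by apply (re_le_Cmod (x, y)).
  assert (Hy : Rabs y <= m) by apply (Im_le_Cmod (x, y)).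
  assert (Hm : m ^ 2 = x ^ 2 + y ^ 2) by apply (Cmod2_alt (x, y)).
  assert (H1 : 1 <= exp (Rabs x))
    by (pose proof (exp_ineq1_le (Rabs x)); pose proof (Rabs_pos x); lra).
  assert (He : exp (Rabs x) <= exp m) by now apply exp_le_exp.
  assert (Hex : exp x <= exp (Rabs x)) by apply exp_le_exp, Rle_abs.
  pose proof (exp_pos x) as Hpos.
  eapply Rle_trans; [apply Cmod_le_Re_Im|].
  unfold Cexp; simpl.
  replace (exp x * cos y + - (1) + - x) with ((exp x - 1 - x) + exp x * (cos y - 1)) by ring.
  replace (exp x * sin y + - 0 + - y) with (exp x * (sin y - y) + y * (exp x - 1)) by ring.
  pose proof (exp_taylor_1 x) as E1; pose proof (exp_sub_1_abs_le x) as E2.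
  pose proof (cos_taylor_1 y) as E3; pose proof (sin_taylor_1 y) as E4.
  pose proof (Rabs_triang (exp x - 1 - x) (exp x * (cos y - 1))) as T1.
  pose proof (Rabs_triang (exp x * (sin y - y)) (y * (exp x - 1))) as T2.
  rewrite Rabs_mult, (Rabs_pos_eq (exp x)) in T1 by lra.
  rewrite !(Rabs_mult (exp x)), (Rabs_mult y), (Rabs_pos_eq (exp x)) in T2 by lra.
  assert (B1 : exp x * Rabs (cos y - 1) <= exp (Rabs x) * y ^ 2)
    by (apply Rmult_le_compat; try apply Rabs_pos; lra).
  assert (B2 : exp x * Rabs (sin y - y) <= exp (Rabs x) * y ^ 2)
    by (apply Rmult_le_compat; try apply Rabs_pos; lra).
  assert (B3 : Rabs y * Rabs (exp x - 1) <= Rabs y * (Rabs x * exp (Rabs x)))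
    by (apply Rmult_le_compat_l; [apply Rabs_pos | lra]).
  rewrite <- (pow2_abs x), <- (pow2_abs y) in *.
  pose proof (Rabs_pos x); pose proof (Rabs_pos y).
  set (E := exp (Rabs x)) in *; set (X := Rabs x) in *; set (Y := Rabs y) in *.
  assert (X * Y <= X ^ 2 + Y ^ 2) by nra.
  assert (X * Y * E <= (X ^ 2 + Y ^ 2) * E)
    by (apply Rmult_le_compat_r; lra).
  apply Rle_trans with (3 * m ^ 2 * E).
  { rewrite Hm.
    assert (0 <= X ^ 2 * E) by (apply Rmult_le_pos; [apply pow2_ge_0 | lra]).
    lra. }
  apply Rmult_le_compat_l; [nra | lra].
Qed.

Lemma Cexp_sub_1_le w : Re w <= 0 -> Cmod (Cexp w - 1)%C <= 3 * Cmod w.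
Proof.
  destruct w as [x y]; simpl; intros Hx0; set (m := Cmod (x, y)).
  assert (Hx : Rabs x <= m) by apply (re_le_Cmod (x, y)).
  assert (Hy : Rabs y <= m) by apply (Im_le_Cmod (x, y)).
  assert (Hex : exp x <= 1) by (rewrite <- exp_0; now apply exp_le_exp).
  pose proof (exp_pos x) as Hpos.
  eapply Rle_trans; [apply Cmod_le_Re_Im|].
  unfold Cexp; simpl.
  replace (exp x * cos y + - (1)) with ((exp x - 1) + exp x * (cos y - 1)) by ring.
  replace (exp x * sin y + - 0) with (exp x * sin y) by ring.
  pose proof (exp_sub_1_abs_le_nonpos x Hx0).
  pose proof (cos_sub_1_abs_le y); pose proof (sin_abs_le y).
  pose proof (Rabs_triang (exp x - 1) (exp x * (cos y - 1))) as T1.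
  rewrite !Rabs_mult, (Rabs_pos_eq (exp x)) in * by lra.
  pose proof (Rabs_pos (cos y - 1)); pose proof (Rabs_pos (sin y)).
  nra.
Qed.

Lemma Cpow_sub_le a b K n :
  Cmod a <= K -> Cmod b <= K ->
  Cmod (a ^ S n - b ^ S n)%C <= INR (S n) * K ^ n * Cmod (a - b)%C.
Proof.
  intros Ha Hb; induction n as [|n IH].
  - rewrite !Cpow_1_r; simpl; lra.
  - rewrite (Cpow_S a), (Cpow_S b).
    replace (a * a ^ S n - b * b ^ S n)%C
      with (a * (a ^ S n - b ^ S n) + (a - b) * b ^ S n)%C by ring.
    eapply Rle_trans; [apply Cmod_triangle|].
    rewrite !Cmod_mult, Cmod_pow, (S_INR (S n)).
    assert (H0 : 0 <= K) by (pose proof (Cmod_ge_0 a); lra).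
    assert (Cmod b ^ S n <= K ^ S n)
      by (apply pow_incr; split; [apply Cmod_ge_0 | assumption]).
    assert (Cmod a * Cmod (a ^ S n - b ^ S n)%C
      <= K * (INR (S n) * K ^ n * Cmod (a - b)%C))
      by (apply Rmult_le_compat; try apply Cmod_ge_0; assumption).
    pose proof (Cmod_ge_0 (a - b)%C).
    change (K ^ S n) with (K * K ^ n) in *; nra.
Qed.

Lemma exp_INR_mult n x : exp (INR n * x) = exp x ^ n.
Proof.
  induction n as [|n IH]; [simpl; rewrite Rmult_0_l; apply exp_0|].
  rewrite S_INR; simpl; rewrite <- IH, <- exp_plus; f_equal; ring.
Qed.

Lemma Cexp_INR_mult n z : Cexp (RtoC (INR n) * z)%C = (Cexp z ^ n)%C.
Proof.
  induction n as [|n IH].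
  - simpl; rewrite Cmult_0_l; apply Cexp_0.
  - rewrite S_INR, RtoC_plus, Cpow_S, <- IH, <- Cexp_plus; f_equal; ring.
Qed.

(** Uniformity on bounded sets makes [exp] of a bounded function a uniform limit
    of polynomials in that function. *)
Lemma Cexp_power_limit (B eta : R) :
  0 < eta ->
  exists n : nat, forall z : C, Cmod z <= B ->
    Cmod (Cexp z - (1 + z * RtoC (/ INR n)) ^ n)%C <= eta.
Proof.
  intros Heta; set (B' := Rabs B).
  destruct (INR_archimed eta (3 * B' ^ 2 * exp B' * exp B')) as [n Hn]; [lra|].
  exists (S n); intros z Hz0.
  assert (Hz : Cmod z <= B') by (pose proof (Rle_abs B); unfold B'; lra).
  assert (HB : 0 <= B') by apply Rabs_pos.
  assert (Hpos : 0 < INR (S n)) by (apply lt_0_INR; lia).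
  assert (Hinv : 0 < / INR (S n)) by now apply Rinv_0_lt_compat.
  set (h := (z * RtoC (/ INR (S n)))%C).
  assert (Hh : Cmod h = Cmod z * / INR (S n))
    by (unfold h; rewrite Cmod_mult, Cmod_R, Rabs_pos_eq; lra).
  assert (Hh2 : Cmod h <= B' * / INR (S n)) by (rewrite Hh; nra).
  assert (Hz' : z = (RtoC (INR (S n)) * h)%C).
  { unfold h; transitivity (z * (RtoC (INR (S n)) * RtoC (/ INR (S n))))%C; [|ring].
    rewrite <- RtoC_mult, Rinv_r by lra; ring. }
  rewrite Hz' at 1; rewrite Cexp_INR_mult.
  set (K := exp (B' * / INR (S n))).
  assert (HKh : exp (Cmod h) <= K) by now apply exp_le_exp.
  assert (HKn : K ^ S n = exp B').
  { unfold K; rewrite <- exp_INR_mult; f_equal; field; lra. }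
  assert (H1K : 1 <= K).
  { unfold K; pose proof (exp_ineq1_le (B' * / INR (S n))); nra. }
  eapply Rle_trans; [apply (Cpow_sub_le _ _ K)|].
  - rewrite Cmod_Cexp; eapply Rle_trans; [apply exp_le_exp, Re_le_Cmod | exact HKh].
  - eapply Rle_trans; [apply Cmod_triangle|]; rewrite Cmod_1.
    eapply Rle_trans; [apply exp_ineq1_le | exact HKh].
  - assert (HKn' : K ^ n <= exp B')
      by (rewrite <- HKn; apply Rle_pow; [assumption | lia]).
    assert (HK1 : K <= exp B').
    { rewrite <- HKn; rewrite <- (pow_1 K) at 1; apply Rle_pow; [assumption | lia]. }
    replace (Cexp h - (1 + h))%C with (Cexp h - 1 - h)%C by ring.
    pose proof (Cexp_taylor_1 h) as HT.
    assert (HT' : Cmod (Cexp h - 1 - h)%C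
              <= 3 * (B' * / INR (S n)) ^ 2 * exp B').
    { eapply Rle_trans; [exact HT|].
      apply Rmult_le_compat; try (left; apply exp_pos); try lra.
      - pose proof (Cmod_ge_0 h); nra.
      - apply Rmult_le_compat_l; [lra|]; apply pow_incr; split; [apply Cmod_ge_0 | lra]. }
    apply Rle_trans with
      (INR (S n) * exp B' * (3 * (B' * / INR (S n)) ^ 2 * exp B')).
    + apply Rmult_le_compat; try apply Cmod_ge_0; try assumption.
      * apply Rmult_le_pos; [lra | apply pow_le; lra].
      * apply Rmult_le_compat_l; lra.
    + replace (INR (S n) * exp B' * (3 * (B' * / INR (S n)) ^ 2 * exp B'))
        with (3 * B' ^ 2 * exp B' * exp B' * / INR (S n)) by (field; lra).
      apply Rmult_le_reg_r with (INR (S n)); [lra|].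
      rewrite Rmult_assoc, Rinv_l, Rmult_1_r by lra.
      rewrite S_INR; nra.
Qed.

(** * Powers [n^{-s}] *)

Lemma ln_INR_nonneg n : 0 <= ln (INR n).
Proof.
  destruct n as [|[|n]].
  - simpl; unfold ln; destruct (Rlt_dec 0 0) as [H|H]; [exfalso; exact (Rlt_irrefl _ H) | apply Rle_refl].
  - simpl; rewrite ln_1; lra.
  - left; rewrite <- ln_1; apply ln_increasing; [lra|].
    apply lt_1_INR; lia.
Qed.

Lemma ln_INR_lt m n : (1 <= m)%nat -> (m < n)%nat -> ln (INR m) < ln (INR n).
Proof.
  intros Hm Hn; apply ln_increasing; [apply lt_0_INR; lia | now apply lt_INR].
Qed.

Lemma ln_INR_le m n : (1 <= m)%nat -> (m <= n)%nat -> ln (INR m) <= ln (INR n).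
Proof.
  intros Hm Hn; destruct (Nat.eq_dec m n) as [->|]; [lra|].
  left; apply ln_INR_lt; lia.
Qed.

Lemma ln_INR_le_INR n : (1 <= n)%nat -> ln (INR n) <= INR n.
Proof.
  intros Hn; rewrite <- (ln_exp (INR n)) at 2.
  apply Rcomplements.ln_le; [apply lt_0_INR; lia|].
  pose proof (exp_ineq1_le (INR n)); lra.
Qed.

Lemma Cmod_npow n s : Cmod (npow_opp n s) = exp (- (Re s * ln (INR n))).
Proof.
  unfold npow_opp; rewrite Cmod_Cexp, re_opp, re_scal_r; reflexivity.
Qed.

Lemma npow_plus n s t : npow_opp n (s + t)%C = (npow_opp n s * npow_opp n t)%C.
Proof. unfold npow_opp; rewrite <- Cexp_plus; f_equal; ring. Qed.

Lemma npow_1 s : npow_opp 1 s = RtoC 1.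
Proof.
  unfold npow_opp; simpl; rewrite ln_1.
  replace (- (s * 0))%C with (RtoC 0) by ring; apply Cexp_0.
Qed.

Lemma npow_mul m n s :
  (1 <= m)%nat -> (1 <= n)%nat ->
  npow_opp (m * n) s = (npow_opp m s * npow_opp n s)%C.
Proof.
  intros Hm Hn; unfold npow_opp; rewrite <- Cexp_plus, mult_INR, ln_mult, RtoC_plus
    by (apply lt_0_INR; lia).
  f_equal; ring.
Qed.

Lemma npow_real n d : npow_opp n (RtoC d) = RtoC (exp (- (d * ln (INR n)))).
Proof.
  unfold npow_opp, Cexp; rewrite <- RtoC_mult, <- RtoC_opp; simpl.
  rewrite cos_0, sin_0; unfold RtoC; f_equal; ring.
Qed.

Lemma npow_imag n y :
  npow_opp n (Ci * RtoC y)%C = (cos (y * ln (INR n)), - sin (y * ln (INR n))).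
Proof.
  unfold npow_opp, Cexp, Ci, RtoC; simpl.
  match goal with |- (exp ?a * cos ?b, _) = _ =>
    replace a with 0 by ring; replace b with (- (y * ln (INR n))) by ring end.
  rewrite exp_0, cos_neg, sin_neg; f_equal; ring.
Qed.

Lemma npow_lipschitz n R0 s t :
  R0 <= Re s -> R0 <= Re t ->
  Cmod (npow_opp n s - npow_opp n t)%C
    <= 3 * ln (INR n) * exp (- (R0 * ln (INR n))) * Cmod (s - t)%C.
Proof.
  pose proof (ln_INR_nonneg n) as Hl.
  assert (Hwlog : forall s t, R0 <= Re s -> R0 <= Re t -> Re t <= Re s ->
    Cmod (npow_opp n s - npow_opp n t)%C
    <= 3 * ln (INR n) * exp (- (R0 * ln (INR n))) * Cmod (s - t)%C).
  { clear s t; intros s t Hs Ht Hst.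
    replace (npow_opp n s - npow_opp n t)%C
      with (npow_opp n t * (npow_opp n (s - t) - 1))%C
      by (replace s with (t + (s - t))%C at 2 by ring; rewrite npow_plus; ring).
    rewrite Cmod_mult, Cmod_npow.
    assert (H1 : Cmod (npow_opp n (s - t) - 1)%C <= 3 * (Cmod (s - t)%C * ln (INR n))).
    { unfold npow_opp; eapply Rle_trans; [apply Cexp_sub_1_le|].
      - rewrite re_opp, re_scal_r; unfold Cminus; rewrite re_plus, re_opp; nra.
      - rewrite Cmod_opp, Cmod_mult, Cmod_R, (Rabs_pos_eq (ln _)) by assumption; lra. }
    apply Rle_trans with
      (exp (- (R0 * ln (INR n))) * (3 * (Cmod (s - t)%C * ln (INR n)))); [|lra].
    apply Rmult_le_compat; try apply Cmod_ge_0; try assumption;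
      [left; apply exp_pos | apply exp_le_exp; nra]. }
  intros Hs Ht; destruct (Rle_or_lt (Re t) (Re s)) as [H|H]; [now apply Hwlog|].
  replace (npow_opp n s - npow_opp n t)%C
    with (- (npow_opp n t - npow_opp n s))%C by ring.
  replace (s - t)%C with (- (t - s))%C by ring.
  rewrite !Cmod_opp; apply Hwlog; lra.
Qed.

Lemma partial_as_Csum a N s :
  dirichlet_partial a N s = Csum (fun n => a n * npow_opp n s)%C N.
Proof. reflexivity. Qed.

(** * The Fejer kernel and triangular multipliers *)

Definition sinc (x : R) : R := if Req_EM_T x 0 then 1 else sin x / x.

(** The continuous extension of [(1 - cos t) / t ^ 2]. *)
Definition fejer (t : R) : R := / 2 * sinc (t / 2) ^ 2.

Lemma sinc_mul x : x * sinc x = sin x.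
Proof.
  unfold sinc; destruct (Req_EM_T x 0) as [->|]; [rewrite sin_0; ring | field; assumption].
Qed.

Lemma sinc_sub_1_le x : Rabs (sinc x - 1) <= Rabs x.
Proof.
  unfold sinc; destruct (Req_EM_T x 0) as [->|Hx].
  - rewrite Rminus_diag, Rabs_R0; lra.
  - apply Rmult_le_reg_l with (Rabs x); [now apply Rabs_pos_lt|].
    rewrite <- Rabs_mult.
    replace (x * (sin x / x - 1)) with (sin x - x) by (field; assumption).
    eapply Rle_trans; [apply sin_taylor_1|]; rewrite <- pow2_abs; lra.
Qed.

Lemma continuous_sinc x : continuous sinc x.
Proof.
  destruct (Req_dec x 0) as [->|Hx].
  - apply filterlim_locally; intros eps; exists eps; intros y Hy.
    change (Rabs (y - 0) < eps) in Hy; rewrite Rminus_0_r in Hy.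
    change (Rabs (sinc y - sinc 0) < eps).
    replace (sinc 0) with 1 by (unfold sinc; destruct (Req_EM_T 0 0); [reflexivity | lra]).
    eapply Rle_lt_trans; [apply sinc_sub_1_le | exact Hy].
  - apply (continuous_ext_loc _ (fun x => sin x / x)).
    + exists (mkposreal _ (Rabs_pos_lt x Hx)); intros y Hy.
      change (Rabs (y - x) < Rabs x) in Hy.
      unfold sinc; destruct (Req_EM_T y 0) as [->|]; [|reflexivity].
      rewrite Rminus_0_l, Rabs_Ropp in Hy; lra.
    + apply (ex_derive_continuous (fun x => sin x / x)); auto_derive; assumption.
Qed.

Lemma continuous_fejer t : continuous fejer t.
Proof.
  unfold fejer; apply (continuous_mult (fun _ => / 2)); [apply continuous_const|].
  apply (continuous_comp (fun t => sinc (t / 2)) (fun s => s ^ 2)).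
  - apply (continuous_comp (fun t => t / 2) sinc); [|apply continuous_sinc].
    apply (ex_derive_continuous (fun t => t / 2)); auto_derive; exact I.
  - apply (ex_derive_continuous (fun t => t ^ 2)); auto_derive; exact I.
Qed.

Lemma fejer_mul t : t ^ 2 * fejer t = 1 - cos t.
Proof.
  rewrite one_minus_cos, <- (sinc_mul (t / 2)); unfold fejer; field.
Qed.

Lemma fejer_0 : fejer 0 = / 2.
Proof.
  unfold fejer, sinc; replace (0 / 2) with 0 by field.
  destruct (Req_EM_T 0 0); [ring | lra].
Qed.

Lemma fejer_nonneg t : 0 <= fejer t.
Proof. unfold fejer; pose proof (pow2_ge_0 (sinc (t / 2))); lra. Qed.

Lemma fejer_opp t : fejer (- t) = fejer t.
Proof.
  destruct (Req_dec t 0) as [->|Ht]; [now rewrite Ropp_0|].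
  apply Rmult_eq_reg_l with (t ^ 2); [|now apply pow_nonzero].
  rewrite fejer_mul, <- cos_neg, <- fejer_mul; ring.
Qed.

Lemma fejer_abs t : fejer (Rabs t) = fejer t.
Proof. unfold Rabs; destruct (Rcase_abs t); [apply fejer_opp | reflexivity]. Qed.

Lemma ex_RInt_fejer a b : ex_RInt fejer a b.
Proof. apply (@ex_RInt_continuous R_CompleteNormedModule); intros; apply continuous_fejer. Qed.

Lemma RInt_fejer_incr a b : 0 <= a <= b -> RInt fejer 0 a <= RInt fejer 0 b.
Proof.
  intros H; rewrite <- (RInt_Chasles fejer 0 a b) by apply ex_RInt_fejer.
  enough (0 <= RInt fejer a b) by (unfold plus; simpl; lra).
  apply RInt_ge_0; [lra | apply ex_RInt_fejer | intros; apply fejer_nonneg].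
Qed.

Lemma RInt_fejer_bounded T : 1 <= T -> RInt fejer 0 T <= RInt fejer 0 1 + 2.
Proof.
  intros HT; rewrite <- (RInt_Chasles fejer 0 1 T) by apply ex_RInt_fejer.
  enough (RInt fejer 1 T <= 2) by (unfold plus; simpl; lra).
  assert (HI : is_RInt (fun t => 2 / t ^ 2) 1 T (minus (- 2 / T) (- 2 / 1))).
  { apply (is_RInt_derive (fun t => - 2 / t)); intros x Hx;
      rewrite Rmin_left, Rmax_right in Hx by lra.
    - auto_derive; [lra | field; lra].
    - apply (ex_derive_continuous (fun t => 2 / t ^ 2)); auto_derive.
      apply Rgt_not_eq; nra. }
  eapply Rle_trans.
  - eapply (is_RInt_le fejer _ 1 T _ _ HT); [apply (@RInt_correct R_CompleteNormedModule), ex_RInt_fejer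
      | exact HI |].
    intros x Hx; apply Rmult_le_reg_l with (x ^ 2); [nra|].
    rewrite fejer_mul; field_simplify; [|lra]; pose proof (COS_bound x); lra.
  - unfold minus, plus, opp; simpl.
    assert (0 < / T) by (apply Rinv_0_lt_compat; lra); lra.
Qed.

(** The Dirichlet-type integral [c]; its value is [PI / 2], but only its positivity
    matters, since it cancels in [fejer_mean_le]. *)
Lemma fejer_integral :
  exists c : R, 0 < c /\ is_lim (fun T => RInt fejer 0 T) p_infty c.
Proof.
  destruct (completeness (fun v => exists T, 0 <= T /\ v = RInt fejer 0 T)) as [c [Hub Hlub]].
  - exists (RInt fejer 0 1 + 2); intros v [T [HT ->]].
    destruct (Rle_or_lt 1 T); [now apply RInt_fejer_bounded|].
    pose proof (RInt_fejer_incr T 1); lra.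
  - exists (RInt fejer 0 0), 0; split; [lra | reflexivity].
  - exists c; split.
    + apply Rlt_le_trans with (RInt fejer 0 1); [|apply Hub; exists 1; split; [lra | reflexivity]].
      apply RInt_gt_0; [lra | | intros; apply continuous_fejer].
      intros x Hx; apply Rmult_lt_reg_l with (x ^ 2); [nra|].
      rewrite fejer_mul, one_minus_cos, Rmult_0_r.
      assert (0 < sin (x / 2)) by (apply sin_gt_0; pose proof PI2_1; lra).
      nra.
    + apply is_lim_spec; intros eps.
      assert (Hex : exists T0, 0 <= T0 /\ c - eps < RInt fejer 0 T0).
      { apply Classical_Prop.NNPP; intros Hn.
        enough (c <= c - eps) by (pose proof (cond_pos eps); lra).
        apply Hlub; intros v [T [HT ->]].
        apply Rnot_lt_le; intros Hlt; apply Hn; exists T; tauto. }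
      destruct Hex as [T0 [HT0 Hc]]; exists T0; intros T HT.
      pose proof (RInt_fejer_incr T0 T ltac:(lra)).
      assert (RInt fejer 0 T <= c) by (apply Hub; exists T; split; [lra | reflexivity]).
      apply Rabs_lt_between'; lra.
Qed.

Lemma is_RInt_fejer_scaled x T :
  is_RInt (fun t => x ^ 2 * fejer (x * t)) 0 T (Rabs x * RInt fejer 0 (Rabs x * T)).
Proof.
  pose proof (@RInt_correct R_CompleteNormedModule fejer 0 (Rabs x * T) (ex_RInt_fejer _ _)) as H.
  replace 0 with (Rabs x * 0 + 0) in H at 1 by ring.
  replace (Rabs x * T) with (Rabs x * T + 0) in H at 1 by ring.
  apply (is_RInt_comp_lin fejer) in H.
  apply (is_RInt_scal _ _ _ (Rabs x)) in H.
  eapply is_RInt_ext; [|exact H]; intros t _.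
  unfold scal; simpl; unfold mult; simpl.
  rewrite Rplus_0_r, <- (fejer_abs (x * t)), Rabs_mult.
  rewrite <- (fejer_abs (Rabs x * t)), Rabs_mult, Rabs_Rabsolu.
  rewrite <- Rmult_assoc; f_equal; fold (x ^ 2); rewrite <- (pow2_abs x); ring.
Qed.

Lemma is_lim_seq_fejer_scaled (c x : R) :
  is_lim (fun T => RInt fejer 0 T) p_infty c ->
  is_lim_seq (fun n => Rabs x * RInt fejer 0 (Rabs x * INR n)) (c * Rabs x).
Proof.
  intros Hc; destruct (Req_dec x 0) as [->|Hx].
  - rewrite Rabs_R0, Rmult_0_r; apply is_lim_seq_ext with (fun _ => 0).
    + intros; ring.
    + apply is_lim_seq_const.
  - rewrite Rmult_comm; apply (is_lim_seq_scal_l _ (Rabs x) (Finite c)).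
    apply (is_lim_comp_seq (fun T => RInt fejer 0 T) _ p_infty); [exact Hc | |].
    + exists 0%nat; intros; discriminate.
    + replace p_infty with (Rbar_mult (Rabs x) p_infty).
      * apply is_lim_seq_scal_l, is_lim_seq_INR.
      * apply is_Rbar_mult_unique, is_Rbar_mult_sym, is_Rbar_mult_p_infty_pos.
        now apply Rabs_pos_lt.
Qed.

(** The triangle function of half-width [r]: [max (1 - |v| / r) 0]. *)
Definition tri (r v : R) : R := (Rabs (v + r) + Rabs (v - r) - 2 * Rabs v) / (2 * r).

Lemma fejer_cos r v y :
  r ^ 2 * fejer (r * y) * cos (v * y)
  = / 2 * ((v + r) ^ 2 * fejer ((v + r) * y) + (v - r) ^ 2 * fejer ((v - r) * y)
           - 2 * (v ^ 2 * fejer (v * y))).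
Proof.
  destruct (Req_dec y 0) as [->|Hy].
  - rewrite !Rmult_0_r, fejer_0, cos_0; field.
  - apply Rmult_eq_reg_l with (y ^ 2); [|now apply pow_nonzero].
    transitivity ((r * y) ^ 2 * fejer (r * y) * cos (v * y)); [ring|].
    rewrite fejer_mul.
    transitivity (/ 2 * (((v + r) * y) ^ 2 * fejer ((v + r) * y)
      + ((v - r) * y) ^ 2 * fejer ((v - r) * y) - 2 * ((v * y) ^ 2 * fejer (v * y)))); [|ring].
    rewrite !fejer_mul.
    replace ((v + r) * y) with (v * y + r * y) by ring.
    replace ((v - r) * y) with (v * y - r * y) by ring.
    rewrite cos_plus, cos_minus; field.
Qed.

(** The triangle function is the Fourier transform of a nonnegative kernel of
    integral 1, so that multiplying the frequencies of a trigonometric polynomial by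
    it averages the translates of the polynomial. *)
Lemma fejer_mean_le (L : nat) (x v : nat -> R) (r M : R) :
  0 < r ->
  (forall y : R, Rsum (fun n => x n * cos (v n * y)) L <= M) ->
  Rsum (fun n => x n * tri r (v n)) L <= M.
Proof.
  intros Hr HM; destruct fejer_integral as [c [Hc Hlim]].
  set (F := fun z T => Rabs z * RInt fejer 0 (Rabs z * T)).
  set (h := fun z T => F (z + r) T + F (z - r) T - 2 * F z T).
  assert (Hint : forall T,
    is_RInt (fun y => r ^ 2 * fejer (r * y) * Rsum (fun n => x n * cos (v n * y)) L) 0 T
      (Rsum (fun n => x n * (/ 2 * h (v n) T)) L)).
  { intros T; clear HM; induction L as [|L IH].
    - rewrite Rsum_0; apply is_RInt_ext with (fun _ => 0).
      + intros; rewrite Rsum_0; symmetry; apply Rmult_0_r.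
      + pose proof (is_RInt_const 0 T 0) as H0.
        unfold scal in H0; simpl in H0; unfold mult in H0; simpl in H0.
        now rewrite Rmult_0_r in H0.
    - rewrite Rsum_S.
      pose proof (is_RInt_fejer_scaled (v (S L) + r) T) as I1.
      pose proof (is_RInt_fejer_scaled (v (S L) - r) T) as I2.
      pose proof (is_RInt_fejer_scaled (v (S L)) T) as I3.
      apply (is_RInt_scal _ _ _ 2) in I3.
      pose proof (is_RInt_minus _ _ _ _ _ _ (is_RInt_plus _ _ _ _ _ _ I1 I2) I3) as I4.
      apply (is_RInt_scal _ _ _ (/ 2)) in I4.
      apply (is_RInt_scal _ _ _ (x (S L))) in I4.
      eapply is_RInt_ext; [|exact (is_RInt_plus _ _ _ _ _ _ IH I4)].
      intros y _; rewrite Rsum_S.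
      unfold plus, minus, scal, opp; simpl; unfold plus, mult, opp; simpl.
      pose proof (fejer_cos r (v (S L)) y) as HF.
      transitivity (r ^ 2 * fejer (r * y) * Rsum (fun n => x n * cos (v n * y)) L
        + x (S L) * (r ^ 2 * fejer (r * y) * cos (v (S L) * y))); [|ring].
      rewrite HF; ring. }
  assert (Hle : forall T, 0 <= T ->
    Rsum (fun n => x n * (/ 2 * h (v n) T)) L <= M * F r T).
  { intros T HT; pose proof (is_RInt_fejer_scaled r T) as I0.
    apply (is_RInt_scal _ _ _ M) in I0.
    eapply (is_RInt_le _ _ 0 T _ _ HT (Hint T) I0).
    - intros y _; unfold scal; simpl; unfold mult; simpl.
      rewrite (Rmult_comm M); apply Rmult_le_compat_l; [|apply HM].
      apply Rmult_le_pos; [apply pow2_ge_0 | apply fejer_nonneg]. }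
  assert (HlF : forall z, is_lim_seq (fun n => F z (INR n)) (c * Rabs z))
    by (intros z; now apply is_lim_seq_fejer_scaled).
  assert (Hl1 : is_lim_seq (fun n => Rsum (fun k => x k * (/ 2 * h (v k) (INR n))) L)
                  (c * r * Rsum (fun n => x n * tri r (v n)) L)).
  { clear HM Hint Hle; induction L as [|L IH].
    - rewrite Rsum_0, Rmult_0_r; apply is_lim_seq_ext with (fun _ => 0).
      + intros; now rewrite Rsum_0.
      + apply is_lim_seq_const.
    - rewrite Rsum_S, Rmult_plus_distr_l.
      eapply is_lim_seq_ext; [intros n; symmetry; apply Rsum_S|].
      apply is_lim_seq_plus'; [exact IH|].
      replace (c * r * (x (S L) * tri r (v (S L)))) with
        (x (S L) * (/ 2 * (c * Rabs (v (S L) + r) + c * Rabs (v (S L) - r)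
           - 2 * (c * Rabs (v (S L)))))) by (unfold tri; field; lra).
      apply (is_lim_seq_scal_l _ (x (S L)) (Finite _)), (is_lim_seq_scal_l _ (/ 2) (Finite _)).
      apply is_lim_seq_minus'; [apply is_lim_seq_plus'; apply HlF|].
      apply (is_lim_seq_scal_l _ 2 (Finite _)), HlF. }
  assert (Hl2 : is_lim_seq (fun n => M * F r (INR n)) (M * (c * r))).
  { replace (c * r) with (c * Rabs r) by (rewrite Rabs_pos_eq; lra).
    apply (is_lim_seq_scal_l _ M (Finite _)), HlF. }
  pose proof (is_lim_seq_le _ _ _ _ (fun n => Hle (INR n) (pos_INR n)) Hl1 Hl2) as H.
  simpl in H; assert (0 < c * r) by nra.
  apply Rmult_le_reg_l with (c * r); lra.
Qed.

(** The restriction of a Dirichlet polynomial to a vertical line, the [b n] being the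
    values of its terms at the point of height [0]. *)
Definition vert (b : nat -> C) (L : nat) (y : R) : C :=
  Csum (fun n => b n * npow_opp n (Ci * RtoC y))%C L.

Lemma vert_0 b L : vert b L 0 = Csum b L.
Proof.
  apply Csum_ext; intros n _.
  rewrite npow_imag, Rmult_0_l, cos_0, sin_0, Ropp_0; fold (RtoC 1); ring.
Qed.

Lemma partial_vert a L s y :
  dirichlet_partial a L (s + Ci * RtoC y)%C = vert (fun n => a n * npow_opp n s)%C L y.
Proof.
  rewrite partial_as_Csum; apply Csum_ext; intros n _; rewrite npow_plus; ring.
Qed.

Lemma Cmod_le_of_Re Q M :
  (forall w, Cmod w = 1 -> Re (w * Q)%C <= M) -> Cmod Q <= M.
Proof.
  intros H; destruct (Ceq_dec Q (RtoC 0)) as [->|HQ].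
  - rewrite Cmod_0; specialize (H (RtoC 1) Cmod_1).
    rewrite Cmult_0_r in H; exact H.
  - pose proof (proj1 (Cmod_gt_0 Q) HQ) as Hpos.
    specialize (H (RtoC (/ Cmod Q) * Cconj Q)%C).
    rewrite <- Cmult_assoc, (Cmult_comm (Cconj Q)), <- Cmod2_conj in H.
    rewrite Cmod_mult, Cmod_R, Cmod_conj, Rabs_pos_eq in H
      by (left; now apply Rinv_0_lt_compat).
    rewrite re_scal_l in H.
    replace (Cmod Q) with (/ Cmod Q * Cmod Q ^ 2) at 1 by (field; lra).
    apply H; field; lra.
Qed.

(** [K] bounds the norm of the multiplier for the sup norm on a vertical line. Evaluating
    the result at height [0] only is enough, since translations along the line act on the
    coefficients and commute with multipliers. *)
Definition multiplier (m : R -> R) (K : R) : Prop :=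
  forall (b : nat -> C) (L : nat) (M : R),
    (forall y, Cmod (vert b L y) <= M) ->
    Cmod (Csum (fun n => RtoC (m (ln (INR n))) * b n)%C L) <= K * M.

Lemma multiplier_ext m m' K :
  (forall x, 0 <= x -> m x = m' x) -> multiplier m K -> multiplier m' K.
Proof.
  intros E H b L M HM.
  rewrite (Csum_ext _ (fun n => RtoC (m (ln (INR n))) * b n)%C); [now apply H|].
  intros n _; now rewrite E by apply ln_INR_nonneg.
Qed.

Lemma multiplier_le m K K' : K <= K' -> multiplier m K -> multiplier m K'.
Proof.
  intros HK H b L M HM.
  assert (0 <= M) by (pose proof (HM 0); pose proof (Cmod_ge_0 (vert b L 0)); lra).
  eapply Rle_trans; [now apply H | nra].
Qed.

Lemma multiplier_lin m1 m2 K1 K2 p q :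
  multiplier m1 K1 -> multiplier m2 K2 ->
  multiplier (fun x => p * m1 x + q * m2 x) (Rabs p * K1 + Rabs q * K2).
Proof.
  intros H1 H2 b L M HM.
  rewrite (Csum_ext _ (fun n => RtoC p * (RtoC (m1 (ln (INR n))) * b n)
                     + RtoC q * (RtoC (m2 (ln (INR n))) * b n))%C).
  2: intros n _; rewrite RtoC_plus, !RtoC_mult; ring.
  rewrite Csum_plus, !Csum_scal.
  eapply Rle_trans; [apply Cmod_triangle|].
  rewrite !Cmod_mult, !Cmod_R, Rmult_plus_distr_r, !Rmult_assoc.
  apply Rplus_le_compat; apply Rmult_le_compat_l; try apply Rabs_pos; auto.
Qed.

(** Modulating by [mu] moves the triangle without changing the sup norm; the real case
    is applied to every rotation of the coefficients. *)
Lemma tri_multiplier mu r : 0 < r -> multiplier (fun x => tri r (x - mu)) 1.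
Proof.
  intros Hr b L M HM; rewrite Rmult_1_l.
  apply Cmod_le_of_Re; intros w Hw.
  rewrite <- Csum_scal, Re_Csum.
  rewrite (Rsum_ext _ (fun n => Re (w * b n)%C * tri r (ln (INR n) - mu))).
  2: { intros n _; rewrite Cmult_assoc, (Cmult_comm w), <- Cmult_assoc, re_scal_l; ring. }
  apply fejer_mean_le; [assumption|]; intros y.
  set (E := fun y => (cos (mu * y), sin (mu * y)) : C).
  assert (HE : forall y, Cmod (E y) = 1).
  { intros z; unfold E, Cmod; simpl.
    rewrite !Rmult_1_r, Rplus_comm; fold (Rsqr (cos (mu * z))) (Rsqr (sin (mu * z))).
    rewrite sin2_cos2; apply sqrt_1. }
  apply Rle_trans with
    (/ 2 * Re (w * (E y * vert b L y + E (- y)%R * vert b L (- y)%R))%C).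
  - right; unfold vert; rewrite <- !Csum_scal, <- Csum_plus, <- Csum_scal, Re_Csum, <- Rsum_scal.
    apply Rsum_ext; intros n _.
    rewrite !npow_imag; unfold E.
    rewrite !Ropp_mult_distr_r_reverse, !Ropp_mult_distr_l_reverse, !cos_neg, !sin_neg.
    rewrite Rmult_minus_distr_r, cos_minus, (Rmult_comm y).
    destruct w as [w1 w2], (b n) as [b1 b2]; simpl; field.
  - pose proof (Re_le_Cmod (w * (E y * vert b L y + E (- y)%R * vert b L (- y)%R))%C) as H.
    rewrite Cmod_mult, Hw in H.
    pose proof (Cmod_triangle (E y * vert b L y) (E (- y)%R * vert b L (- y)%R))%C as H'.
    rewrite !Cmod_mult, !HE in H'; pose proof (HM y); pose proof (HM (- y)); lra.
Qed.

Lemma tri_positive r b L :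
  0 < r -> (forall y, 0 <= Re (vert b L y)) ->
  0 <= Rsum (fun n => tri r (ln (INR n)) * Re (b n)) L.
Proof.
  intros Hr HM.
  enough (Rsum (fun n => (-1 * Re (b n)) * tri r (ln (INR n))) L <= 0) as H.
  { rewrite (Rsum_ext _ (fun n => -1 * (tri r (ln (INR n)) * Re (b n)))) in H
      by (intros; ring).
    rewrite Rsum_scal in H; lra. }
  apply fejer_mean_le; [assumption|]; intros y.
  apply Rle_trans with (- / 2 * Re (vert b L y + vert b L (- y)%R)%C).
  - right; unfold vert; rewrite <- Csum_plus, Re_Csum, <- Rsum_scal.
    apply Rsum_ext; intros n _.
    rewrite !npow_imag, !Ropp_mult_distr_l_reverse, cos_neg, sin_neg, (Rmult_comm y).
    destruct (b n) as [b1 b2]; simpl; field.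
  - rewrite re_plus; pose proof (HM y); pose proof (HM (- y)); lra.
Qed.

(** * Partial sums of Dirichlet polynomials *)

(** The function equal to 1 before [a], to 0 after [a + w], and affine between. *)
Definition trap (a w x : R) : R := (Rabs (x - a - w) - Rabs (x - a)) / (2 * w) + / 2.

(** Halving the width of the slope costs one triangle: this gives the logarithmic
    growth of the norm. *)
Lemma trap_step a w x :
  0 < w -> trap a w x = 1 * trap a (2 * w) x + - / 2 * tri w (x - (a + w)).
Proof.
  intros Hw; unfold trap, tri.
  replace (x - (a + w) + w) with (x - a) by ring.
  replace (x - (a + w) - w) with (x - a - 2 * w) by ring.
  replace (x - (a + w)) with (x - a - w) by ring; field; lra.
Qed.

Lemma trap_multiplier_wide a w : 0 < w -> 0 <= a <= w -> multiplier (trap a w) 3.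
Proof.
  intros Hw Ha; destruct (Req_dec a 0) as [->|Ha0].
  - apply (multiplier_le _ 1); [lra|].
    apply (multiplier_ext (fun x => tri w (x - 0))); [|now apply tri_multiplier].
    intros x Hx; unfold tri, trap; rewrite !Rminus_0_r.
    rewrite (Rabs_pos_eq (x + w)), (Rabs_pos_eq x) by lra; field; lra.
  - apply (multiplier_le _ (Rabs ((a + w) / w) * 1 + Rabs (- (a / w)) * 1)).
    + assert (0 <= a / w <= 1).
      { split; [apply Rmult_le_pos; [lra | left; now apply Rinv_0_lt_compat]|].
        apply Rmult_le_reg_r with w; [lra|]; field_simplify; lra. }
      rewrite Rabs_Ropp, !Rabs_pos_eq; replace ((a + w) / w) with (a / w + 1) by (field; lra); lra.
    + eapply multiplier_ext;
        [|apply multiplier_lin; [apply (tri_multiplier 0 (a + w)) | apply (tri_multiplier 0 a)]; lra].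
      intros x Hx; unfold tri, trap; simpl; rewrite !Rminus_0_r.
      rewrite (Rabs_pos_eq (x + (a + w))), (Rabs_pos_eq (x + a)), (Rabs_pos_eq x) by lra.
      replace (x - (a + w)) with (x - a - w) by ring; field; lra.
Qed.

Lemma trap_multiplier k a w :
  0 < w -> 0 <= a <= 2 ^ k * w -> multiplier (trap a w) (3 + INR k / 2).
Proof.
  revert w; induction k as [|k IH]; intros w Hw Ha.
  - simpl in *; replace (3 + 0 / 2) with 3 by field.
    apply trap_multiplier_wide; lra.
  - apply (multiplier_le _ (Rabs 1 * (3 + INR k / 2) + Rabs (- / 2) * 1)).
    + rewrite Rabs_R1, Rabs_Ropp, Rabs_pos_eq, S_INR; lra.
    + eapply multiplier_ext;
        [intros x _; symmetry; now apply trap_step|].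
      apply (multiplier_lin (trap a (2 * w)) (fun x => tri w (x - (a + w))));
        [apply IH; [lra | simpl in Ha; lra] | now apply tri_multiplier].
Qed.

Lemma ln_le_sub_1 x : 0 < x -> ln x <= x - 1.
Proof.
  intros Hx; pose proof (exp_ineq1_le (ln x)); rewrite exp_ln in H; lra.
Qed.

Lemma ln_INR_gap N : (1 <= N)%nat ->
  / INR (S N) <= ln (INR (S N)) - ln (INR N).
Proof.
  intros HN; assert (H1 : 0 < INR N) by (apply lt_0_INR; lia).
  assert (H2 : INR (S N) = INR N + 1) by apply S_INR.
  pose proof (ln_le_sub_1 (INR N / INR (S N))) as H.
  rewrite ln_div in H by lra.
  replace (INR N / INR (S N) - 1) with (- / INR (S N)) in H by (rewrite H2; field; lra).
  enough (0 < INR N / INR (S N)) by (specialize (H H0); lra).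
  apply Rdiv_lt_0_compat; lra.
Qed.

Lemma partial_sum_log_bound b L M N :
  (forall y, Cmod (vert b L y) <= M) -> (1 <= N <= L)%nat ->
  Cmod (Csum b N) <= (5 + 2 * ln (INR N)) * M.
Proof.
  intros HM HN.
  assert (HM0 : 0 <= M) by (pose proof (HM 0); pose proof (Cmod_ge_0 (vert b L 0)); lra).
  set (a := ln (INR N)); set (w := ln (INR (S N)) - a).
  assert (H1 : 1 <= INR N) by (apply (le_INR 1); lia).
  assert (HSN : INR (S N) = INR N + 1) by apply S_INR.
  assert (Hgap : / INR (S N) <= w) by (apply ln_INR_gap; lia).
  assert (Hinv : 0 < / INR (S N)) by (apply Rinv_0_lt_compat; lra).
  assert (Ha : 0 <= a) by apply ln_INR_nonneg.
  set (j := S (Nat.log2 (S N))).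
  destruct (Nat.log2_spec (S N)) as [Hlo Hhi]; [lia|].
  assert (Hj1 : INR (S N) <= 2 ^ j).
  { replace 2 with (INR 2) by reflexivity; rewrite <- pow_INR; apply le_INR.
    unfold j; lia. }
  assert (Hj2 : 2 ^ j <= 4 * INR N).
  { apply Rle_trans with (2 * INR (S N)); [|lra].
    unfold j; rewrite <- tech_pow_Rmult; apply Rmult_le_compat_l; [lra|].
    replace 2 with (INR 2) by reflexivity; rewrite <- pow_INR; now apply le_INR. }
  (* [2 ^ (2 j) >= (N + 1) ^ 2] compensates both [ln N] and the gap [1 / (N + 1)]. *)
  assert (Hm : multiplier (trap a w) (3 + INR (2 * j) / 2)).
  { apply trap_multiplier; [lra|]; split; [assumption|].
    rewrite Nat.mul_comm, pow_mult.
    apply Rle_trans with (INR (S N) ^ 2 * / INR (S N)).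
    - replace (INR (S N) ^ 2 * / INR (S N)) with (INR (S N)) by (field; lra).
      assert (a <= INR N) by (apply ln_INR_le_INR; lia); lra.
    - apply Rmult_le_compat; try lra; [nra|]; apply pow_incr; lra. }
  specialize (Hm b L M HM).
  replace (Csum (fun n => RtoC (trap a w (ln (INR n))) * b n)%C L) with (Csum b N) in Hm.
  - eapply Rle_trans; [exact Hm|]; apply Rmult_le_compat_r; [assumption|].
    replace (INR (2 * j) / 2) with (INR j) by (rewrite mult_INR; simpl; field).
    assert (Hl : INR j * ln 2 <= 2 * ln 2 + a).
    { rewrite <- ln_pow by lra.
      apply Rle_trans with (ln (4 * INR N)).
      - apply Rcomplements.ln_le; [apply pow_lt; lra | assumption].
      - rewrite ln_mult by lra; unfold a.
        replace 4 with (2 * 2) by ring; rewrite ln_mult; lra. }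
    pose proof ln_lt_2; nra.
  - rewrite <- (Csum_truncate b N L) by lia; apply Csum_ext; intros n Hn; unfold trap.
    destruct (Nat.leb_spec n N) as [H|H].
    + assert (ln (INR n) <= a) by (apply ln_INR_le; lia).
      rewrite !Rabs_left1 by lra.
      replace ((- (ln (INR n) - a - w) - - (ln (INR n) - a)) / (2 * w) + / 2) with 1
        by (field; lra); ring.
    + assert (ln (INR (S N)) <= ln (INR n)) by (apply ln_INR_le; lia).
      assert (a + w = ln (INR (S N))) by (unfold w; ring).
      rewrite !Rabs_pos_eq by lra.
      replace ((ln (INR n) - a - w - (ln (INR n) - a)) / (2 * w) + / 2) with 0
        by (field; lra); ring.
Qed.

(** Abel summation absorbs the logarithm at the price of a shift [d] to the right. *)
Lemma abel_shift d b L M :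
  0 < d -> 0 <= M ->
  (forall N, (1 <= N <= L)%nat -> Cmod (Csum b N) <= (5 + 2 * ln (INR N)) * M) ->
  forall N, (N <= L)%nat ->
    Cmod (Csum (fun n => RtoC (exp (- (d * ln (INR n)))) * b n)%C N)
      <= 3 * (5 + 4 / d) * M.
Proof.
  intros Hd HM HS.
  set (K := 5 + 4 / d).
  assert (HK : 0 < K) by (assert (0 < 4 / d) by (apply Rdiv_lt_0_compat; lra); unfold K; lra).
  (* [n ^ (- d) = h n ^ 2]: one factor [h n] beats the logarithm, the other telescopes *)
  set (h := fun n => exp (- (d / 2 * ln (INR n)))).
  set (e := fun n => exp (- (d * ln (INR n)))).
  assert (Hh : forall n, 0 < h n) by (intros; apply exp_pos).
  assert (He : forall n, e n = h n ^ 2).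
  { intros n; unfold e, h; rewrite <- exp_INR_mult; f_equal; simpl; field. }
  assert (Hh1 : forall n, h n <= 1).
  { intros n; unfold h; rewrite <- exp_0; apply exp_le_exp.
    pose proof (ln_INR_nonneg n); nra. }
  assert (HS' : forall N, (1 <= N <= L)%nat -> h N * Cmod (Csum b N) <= K * M).
  { intros N HN; apply Rle_trans with (h N * (K * / h N * M)).
    - apply Rmult_le_compat_l; [left; apply Hh|].
      eapply Rle_trans; [now apply HS|]; apply Rmult_le_compat_r; [assumption|].
      set (x := d / 2 * ln (INR N)).
      assert (Hx : 0 <= x) by (pose proof (ln_INR_nonneg N); unfold x; nra).
      replace (/ h N) with (exp x) by (unfold h; rewrite exp_Ropp, Rinv_inv; reflexivity).
      replace (2 * ln (INR N)) with (4 / d * x) by (unfold x; field; lra).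
      unfold K; pose proof (exp_ineq1_le x).
      assert (0 < 4 / d) by (apply Rdiv_lt_0_compat; lra); nra.
    - right; field; apply Rgt_not_eq, Hh. }
  assert (Hind : forall N, (1 <= N <= L)%nat ->
    Cmod (Csum (fun n => RtoC (e n) * b n)%C N - RtoC (e N) * Csum b N)%C
      <= 2 * K * M * (1 - h N)).
  { induction N as [|[|N] IH]; intros HN; [lia| |].
    - rewrite !Csum_S, !Csum_0.
      replace (0 + e 1%nat * b 1%nat - e 1%nat * (0 + b 1%nat))%C with (RtoC 0) by ring.
      rewrite Cmod_0; specialize (Hh1 1%nat).
      apply Rmult_le_pos; [nra | lra].
    - rewrite (Csum_S _ (S N)), (Csum_S b (S N)); set (n := S N) in *.
      match goal with |- Cmod ?z <= _ => replace z with
        ((Csum (fun n => RtoC (e n) * b n) n - RtoC (e n) * Csum b n)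
         + RtoC (e n - e (S n)) * Csum b n)%C by (rewrite RtoC_minus; ring) end.
      eapply Rle_trans; [apply Cmod_triangle|].
      specialize (IH ltac:(lia)); specialize (HS' n ltac:(lia)).
      rewrite (Cmod_mult (RtoC (e n - e (S n)))), Cmod_R, (He (S n)).
      replace (e n - h (S n) ^ 2) with (h n ^ 2 - h (S n) ^ 2) by now rewrite (He n).
      assert (Hdec : h (S n) <= h n).
      { unfold h; apply exp_le_exp.
        pose proof (ln_INR_le n (S n) ltac:(lia) ltac:(lia)); nra. }
      pose proof (Hh n); pose proof (Hh (S n)).
      rewrite Rabs_pos_eq by nra.
      assert ((h n ^ 2 - h (S n) ^ 2) * Cmod (Csum b n)
        <= 2 * (h n - h (S n)) * (h n * Cmod (Csum b n))).
      { replace (2 * (h n - h (S n)) * (h n * Cmod (Csum b n)))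
          with ((2 * (h n - h (S n)) * h n) * Cmod (Csum b n)) by ring.
        apply Rmult_le_compat_r; [apply Cmod_ge_0 | nra]. }
      assert (2 * (h n - h (S n)) * (h n * Cmod (Csum b n)) <= 2 * (h n - h (S n)) * (K * M))
        by (apply Rmult_le_compat_l; lra).
      lra. }
  intros N HN; destruct (Nat.eq_dec N 0) as [->|HN0].
  { rewrite Csum_0, Cmod_0; apply Rmult_le_pos; [lra | assumption]. }
  assert (HN1 : (1 <= N <= L)%nat) by lia.
  specialize (Hind N HN1); specialize (HS' N HN1).
  change (Csum (fun n => RtoC (exp (- (d * ln (INR n)))) * b n)%C N)
    with (Csum (fun n => RtoC (e n) * b n)%C N).
  replace (Csum (fun n => RtoC (e n) * b n)%C N) with
    ((Csum (fun n => RtoC (e n) * b n) N - RtoC (e N) * Csum b N)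
      + RtoC (e N) * Csum b N)%C by ring.
  eapply Rle_trans; [apply Cmod_triangle|].
  rewrite (Cmod_mult (RtoC (e N))), Cmod_R.
  replace (Rabs (e N)) with (h N ^ 2)
    by (rewrite He, Rabs_pos_eq; [reflexivity | apply pow2_ge_0]).
  pose proof (Hh N); pose proof (Hh1 N); pose proof (Cmod_ge_0 (Csum b N)).
  assert (0 <= K * M) by nra.
  assert (h N ^ 2 * Cmod (Csum b N) <= K * M)
    by (assert (0 <= h N * Cmod (Csum b N)) by nra; nra).
  assert (0 <= K * M * h N) by (apply Rmult_le_pos; lra).
  lra.
Qed.

(** A quantitative form of Bohr's theorem. The constant depends neither on the length of
    the polynomial nor on [N], so the estimate passes to limits of polynomials. *)
Lemma bohr_partial_sums d :
  0 < d ->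
  exists K : R, 0 < K /\
    forall (a : nat -> C) (L : nat) (s : C) (M : R),
      (forall y : R, Cmod (dirichlet_partial a L (s + Ci * RtoC y)%C) <= M) ->
      forall N, (N <= L)%nat ->
        Cmod (dirichlet_partial a N (s + RtoC d)%C) <= K * M.
Proof.
  intros Hd; exists (3 * (5 + 4 / d)); split.
  { assert (0 < 4 / d) by (apply Rdiv_lt_0_compat; lra); lra. }
  intros a L s M HM N HN.
  assert (HM0 : 0 <= M).
  { eapply Rle_trans; [apply Cmod_ge_0 | apply (HM 0)]. }
  rewrite partial_as_Csum.
  rewrite (Csum_ext _ (fun n => RtoC (exp (- (d * ln (INR n)))) * (a n * npow_opp n s))%C)
    by (intros n _; rewrite npow_plus, npow_real; ring).
  apply (abel_shift d _ L); try assumption.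
  intros n Hn; apply (partial_sum_log_bound _ L); [|assumption].
  intros y; rewrite <- partial_vert; apply HM.
Qed.

(** * Dirichlet polynomials *)

Definition dpoly (P : C -> C) : Prop :=
  exists (a : nat -> C) (L : nat), forall s, P s = dirichlet_partial a L s.

Lemma dpoly_coefs P :
  dpoly P ->
  exists (a : nat -> C) (L : nat),
    (forall n, (L < n)%nat -> a n = RtoC 0) /\
    (forall s N, (L <= N)%nat -> P s = dirichlet_partial a N s).
Proof.
  intros [a [L H]]; exists (fun n => if (n <=? L)%nat then a n else RtoC 0), L; split.
  - intros n Hn; now rewrite (proj2 (Nat.leb_gt n L)).
  - intros s N HN; rewrite H, !partial_as_Csum, <- (Csum_truncate _ L N HN).
    apply Csum_ext; intros n _; destruct (n <=? L)%nat; ring.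
Qed.

Lemma dpoly_ext P Q : (forall s, P s = Q s) -> dpoly P -> dpoly Q.
Proof. intros E [a [L H]]; exists a, L; intros s; now rewrite <- E. Qed.

Lemma dpoly_plus P Q : dpoly P -> dpoly Q -> dpoly (fun s => P s + Q s)%C.
Proof.
  intros HP HQ.
  destruct (dpoly_coefs P HP) as [a [L [_ Ha]]], (dpoly_coefs Q HQ) as [b [L' [_ Hb]]].
  exists (fun n => a n + b n)%C, (Nat.max L L'); intros s.
  rewrite (Ha s (Nat.max L L')), (Hb s (Nat.max L L')), !partial_as_Csum, <- Csum_plus by lia.
  apply Csum_ext; intros; ring.
Qed.

Lemma dpoly_term c n : (1 <= n)%nat -> dpoly (fun s => c * npow_opp n s)%C.
Proof.
  intros Hn; exists (fun k => if (k =? n)%nat then c else RtoC 0), n; intros s.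
  rewrite partial_as_Csum; destruct n as [|n]; [lia|].
  rewrite Csum_S, Nat.eqb_refl.
  rewrite (Csum_ext _ (fun _ => RtoC 0 * RtoC 0)%C).
  - rewrite Csum_scal; ring.
  - intros k Hk; rewrite (proj2 (Nat.eqb_neq k (S n))) by lia; ring.
Qed.

Lemma dpoly_const c : dpoly (fun _ => c).
Proof.
  apply (dpoly_ext (fun s => c * npow_opp 1 s)%C); [|apply dpoly_term; lia].
  intros s; rewrite npow_1; ring.
Qed.

Lemma dpoly_Csum (f : nat -> C -> C) N :
  (forall n, (1 <= n <= N)%nat -> dpoly (f n)) ->
  dpoly (fun s => Csum (fun n => f n s) N).
Proof.
  induction N as [|N IH]; intros H.
  - apply (dpoly_ext (fun _ => RtoC 0)); [intros; now rewrite Csum_0 | apply dpoly_const].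
  - apply (dpoly_ext (fun s => Csum (fun n => f n s) N + f (S N) s)%C).
    + intros s; now rewrite Csum_S.
    + apply dpoly_plus; [apply IH; intros n Hn|]; apply H; lia.
Qed.

Lemma dpoly_mult P Q : dpoly P -> dpoly Q -> dpoly (fun s => P s * Q s)%C.
Proof.
  intros [a [L HP]] [b [L' HQ]].
  apply (dpoly_ext (fun s => Csum (fun m =>
    Csum (fun n => (a m * b n) * npow_opp (m * n) s) L') L)%C).
  - intros s; rewrite HP, HQ, !partial_as_Csum.
    rewrite (Cmult_comm (Csum _ L)), <- Csum_scal; apply Csum_ext; intros m Hm.
    rewrite Cmult_comm, <- Csum_scal; apply Csum_ext; intros n Hn.
    rewrite npow_mul by lia; ring.
  - apply dpoly_Csum; intros m Hm; apply dpoly_Csum; intros n Hn.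
    apply dpoly_term; nia.
Qed.

Lemma Cmod_npow_le_1 n s : 0 <= Re s -> Cmod (npow_opp n s) <= 1.
Proof.
  intros Hs; rewrite Cmod_npow, <- exp_0; apply exp_le_exp.
  pose proof (ln_INR_nonneg n); nra.
Qed.

Lemma dpoly_bounded P :
  dpoly P -> exists B, 0 <= B /\ forall s, 0 < Re s -> Cmod (P s) <= B.
Proof.
  intros [a [L H]]; exists (Rsum (fun n => Cmod (a n)) L); split.
  - apply Rsum_nonneg; intros; apply Cmod_ge_0.
  - intros s Hs; rewrite H, partial_as_Csum; apply Cmod_Csum_le; intros n _.
    rewrite Cmod_mult; pose proof (Cmod_npow_le_1 n s ltac:(lra)).
    pose proof (Cmod_ge_0 (a n)); nra.
Qed.

(** * Uniform limits of Dirichlet polynomials *)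

(** The functions that are, on every half-plane [Re s > eps > 0], uniform limits of
    Dirichlet polynomials. They are the sums of the Dirichlet series that converge
    uniformly on each of these half-planes ([uapprox_cvg]), but this description makes
    the stability under products, exponentials and compositions easy. *)
Definition uapprox (f : C -> C) : Prop :=
  forall eps eta : R, 0 < eps -> 0 < eta ->
  exists P, dpoly P /\ forall s, half_plane eps s -> Cmod (f s - P s)%C <= eta.

Lemma uapprox_dpoly P : dpoly P -> uapprox P.
Proof.
  intros HP eps eta _ Heta; exists P; split; [assumption|]; intros s _.
  unfold Cminus; rewrite Cplus_opp_r, Cmod_0; lra.
Qed.

Lemma uapprox_const c : uapprox (fun _ => c).
Proof. apply uapprox_dpoly, dpoly_const. Qed.

Lemma uapprox_ext f g :
  (forall s, half_plane 0 s -> f s = g s) -> uapprox f -> uapprox g.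
Proof.
  intros E H eps eta He Hn; destruct (H eps eta He Hn) as [P [HP H']].
  exists P; split; [assumption|]; intros s Hs; rewrite <- E; [now apply H'|].
  unfold half_plane in *; lra.
Qed.

Lemma uapprox_of_cvg a f :
  (forall eps, 0 < eps -> dirichlet_cvg_unif a (half_plane eps) f) -> uapprox f.
Proof.
  intros H eps eta He Hn; destruct (H eps He eta Hn) as [N HN].
  exists (dirichlet_partial a N); split; [now exists a, N|].
  intros s Hs; rewrite <- Cmod_opp.
  replace (- (f s - dirichlet_partial a N s))%C with (dirichlet_partial a N s - f s)%C by ring.
  left; now apply HN.
Qed.

(** This allows approximants that are products, exponentials or compositions. *)
Lemma uapprox_closed f :
  (forall eps eta : R, 0 < eps -> 0 < eta ->
    exists g, uapprox g /\ forall s, half_plane eps s -> Cmod (f s - g s)%C <= eta) ->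
  uapprox f.
Proof.
  intros H eps eta He Hn.
  destruct (H eps (eta / 2)) as [g [Hg H1]]; [lra | lra|].
  destruct (Hg eps (eta / 2)) as [P [HP H2]]; [lra | lra|].
  exists P; split; [assumption|]; intros s Hs.
  replace (f s - P s)%C with ((f s - g s) + (g s - P s))%C by ring.
  eapply Rle_trans; [apply Cmod_triangle|].
  specialize (H1 s Hs); specialize (H2 s Hs); lra.
Qed.

Lemma uapprox_bounded f eps :
  uapprox f -> 0 < eps ->
  exists B, 0 <= B /\ forall s, half_plane eps s -> Cmod (f s) <= B.
Proof.
  intros H He; destruct (H eps 1 He Rlt_0_1) as [P [HP H1]].
  destruct (dpoly_bounded P HP) as [B [HB H2]].
  exists (B + 1); split; [lra|]; intros s Hs.
  replace (f s) with ((f s - P s) + P s)%C by ring.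
  eapply Rle_trans; [apply Cmod_triangle|].
  specialize (H1 s Hs); specialize (H2 s); unfold half_plane in Hs; lra.
Qed.

Lemma uapprox_plus f g : uapprox f -> uapprox g -> uapprox (fun s => f s + g s)%C.
Proof.
  intros Hf Hg eps eta He Hn.
  destruct (Hf eps (eta / 2)) as [P [HP H1]]; [lra | lra|].
  destruct (Hg eps (eta / 2)) as [Q [HQ H2]]; [lra | lra|].
  exists (fun s => P s + Q s)%C; split; [now apply dpoly_plus|]; intros s Hs.
  replace (f s + g s - (P s + Q s))%C with ((f s - P s) + (g s - Q s))%C by ring.
  eapply Rle_trans; [apply Cmod_triangle|].
  specialize (H1 s Hs); specialize (H2 s Hs); lra.
Qed.

Lemma uapprox_mult f g : uapprox f -> uapprox g -> uapprox (fun s => f s * g s)%C.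
Proof.
  intros Hf Hg eps eta He Hn.
  destruct (uapprox_bounded f eps Hf He) as [B [HB HfB]].
  destruct (Hg eps (eta / 2 / (B + 1))) as [Q [HQ H2]];
    [lra | apply Rdiv_lt_0_compat; lra|].
  destruct (dpoly_bounded Q HQ) as [B' [HB' HQB]].
  destruct (Hf eps (eta / 2 / (B' + 1))) as [P [HP H1]];
    [lra | apply Rdiv_lt_0_compat; lra|].
  exists (fun s => P s * Q s)%C; split; [now apply dpoly_mult|]; intros s Hs.
  replace (f s * g s - P s * Q s)%C with (f s * (g s - Q s) + (f s - P s) * Q s)%C by ring.
  eapply Rle_trans; [apply Cmod_triangle|]; rewrite !Cmod_mult.
  specialize (H1 s Hs); specialize (H2 s Hs); specialize (HfB s Hs).
  specialize (HQB s); unfold half_plane in Hs.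
  assert (Cmod (f s) * Cmod (g s - Q s)%C <= (B + 1) * (eta / 2 / (B + 1)))
    by (apply Rmult_le_compat; try apply Cmod_ge_0; lra).
  assert (Cmod (f s - P s)%C * Cmod (Q s) <= (eta / 2 / (B' + 1)) * (B' + 1))
    by (apply Rmult_le_compat; try apply Cmod_ge_0; lra).
  replace ((B + 1) * (eta / 2 / (B + 1))) with (eta / 2) in * by (field; lra).
  replace ((eta / 2 / (B' + 1)) * (B' + 1)) with (eta / 2) in * by (field; lra).
  lra.
Qed.

Lemma uapprox_scal k f : uapprox f -> uapprox (fun s => k * f s)%C.
Proof. apply uapprox_mult, uapprox_const. Qed.

Lemma uapprox_pow f n : uapprox f -> uapprox (fun s => f s ^ n)%C.
Proof.
  intros H; induction n as [|n IH]; [apply (uapprox_const (RtoC 1))|].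
  apply (uapprox_ext (fun s => f s * f s ^ n)%C); [intros; now rewrite Cpow_S|].
  now apply uapprox_mult.
Qed.

Lemma uapprox_Csum (f : nat -> C -> C) N :
  (forall n, (1 <= n <= N)%nat -> uapprox (f n)) ->
  uapprox (fun s => Csum (fun n => f n s) N).
Proof.
  induction N as [|N IH]; intros H.
  - apply (uapprox_ext (fun _ => RtoC 0)); [intros; now rewrite Csum_0 | apply uapprox_const].
  - apply (uapprox_ext (fun s => Csum (fun n => f n s) N + f (S N) s)%C).
    + intros s _; now rewrite Csum_S.
    + apply uapprox_plus; [apply IH; intros n Hn|]; apply H; lia.
Qed.

Lemma uapprox_Cexp f : uapprox f -> uapprox (fun s => Cexp (f s)).
Proof.
  intros Hf; apply uapprox_closed; intros eps eta He Hn.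
  destruct (uapprox_bounded f eps Hf He) as [B [_ HB]].
  destruct (Cexp_power_limit B eta Hn) as [n H].
  exists (fun s => (1 + f s * RtoC (/ INR n)) ^ n)%C; split.
  - apply uapprox_pow, uapprox_plus; [apply uapprox_const|].
    apply uapprox_mult; [assumption | apply uapprox_const].
  - intros s Hs; now apply H, HB.
Qed.

(** The reason behind the stability under composition with
    [phi s = c0 * s + psi s]: the map [phi] preserves each half-plane, and
    [n ^ (- phi s) = (n ^ (- s)) ^ c0 * exp (- psi s * ln n)]. *)
Lemma uapprox_comp (c0 : nat) (psi phi g : C -> C) :
  (1 <= c0)%nat ->
  (forall s, half_plane 0 s -> phi s = (RtoC (INR c0) * s + psi s)%C) ->
  (forall s, half_plane 0 s -> 0 <= Re (psi s)) ->
  uapprox psi -> uapprox g -> uapprox (fun s => g (phi s)).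
Proof.
  intros Hc Hphi Hpos Hpsi Hg; apply uapprox_closed; intros eps eta He Hn.
  destruct (Hg eps eta He Hn) as [Q [[a [L HQ]] HQg]].
  exists (fun s => Q (phi s)); split.
  - apply (uapprox_ext (fun s => Csum (fun n =>
      a n * (npow_opp n s ^ c0 * Cexp (- RtoC (ln (INR n)) * psi s))) L)%C).
    + intros s Hs; rewrite HQ, partial_as_Csum; apply Csum_ext; intros n _; f_equal.
      rewrite Hphi, npow_plus by assumption; unfold npow_opp.
      rewrite <- Cexp_INR_mult; f_equal; f_equal; ring.
    + apply uapprox_Csum; intros n Hn'.
      apply uapprox_scal, uapprox_mult.
      * apply uapprox_pow, uapprox_dpoly.
        apply (dpoly_ext (fun s => 1 * npow_opp n s)%C); [intros; ring|].
        apply dpoly_term; lia.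
      * now apply uapprox_Cexp, uapprox_scal.
  - intros s Hs; apply HQg; unfold half_plane in *.
    rewrite Hphi by lra; rewrite re_plus, re_scal_l.
    assert (1 <= INR c0) by now apply (le_INR 1).
    specialize (Hpos s ltac:(lra)); nra.
Qed.

Lemma C_cauchy_cvg (u : nat -> C) :
  (forall eta, 0 < eta -> exists N, forall m m', (N <= m)%nat -> (N <= m')%nat ->
     Cmod (u m - u m')%C <= eta) ->
  exists l, forall eta, 0 < eta -> exists N, forall m, (N <= m)%nat ->
     Cmod (u m - l)%C <= eta.
Proof.
  intros H.
  assert (HR : forall g : C -> R, (forall z w, g (z - w)%C = g z - g w) ->
    (forall z, Rabs (g z) <= Cmod z) -> exists l : R, Un_cv (fun n : nat => g (u n)) l).
  { intros g Hg Hle; destruct (Rcomplete.R_complete (fun n : nat => g (u n))) as [l Hl]; [|now exists l].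
    intros eta Heta; destruct (H (eta / 2)) as [N HN]; [lra|]; exists N; intros m m' Hm Hm'.
    unfold Rdist; rewrite <- Hg; specialize (HN m m' Hm Hm').
    specialize (Hle (u m - u m')%C); lra. }
  destruct (HR Re) as [l1 H1]; [intros; unfold Cminus; now rewrite re_plus, re_opp
    | apply re_le_Cmod |].
  destruct (HR Im) as [l2 H2]; [intros; unfold Cminus; now rewrite im_plus, im_opp
    | apply Im_le_Cmod |].
  exists (l1, l2); intros eta Heta.
  destruct (H1 (eta / 2)) as [N1 HN1]; [lra|]; destruct (H2 (eta / 2)) as [N2 HN2]; [lra|].
  exists (Nat.max N1 N2); intros m Hm.
  eapply Rle_trans; [apply Cmod_le_Re_Im|].
  specialize (HN1 m ltac:(lia)); specialize (HN2 m ltac:(lia)); unfold Rdist in *.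
  unfold Cminus; rewrite re_plus, im_plus, re_opp, im_opp; simpl.
  unfold Rminus in *; lra.
Qed.

Lemma Csum_lim (u : nat -> nat -> C) (l : nat -> C) N :
  (forall n, (1 <= n <= N)%nat -> forall eta, 0 < eta -> exists M, forall m, (M <= m)%nat ->
     Cmod (u m n - l n)%C <= eta) ->
  forall eta, 0 < eta -> exists M, forall m, (M <= m)%nat ->
     Cmod (Csum (u m) N - Csum l N)%C <= eta.
Proof.
  induction N as [|N IH]; intros H eta Heta.
  - exists 0%nat; intros m _; rewrite !Csum_0; unfold Cminus; rewrite Cplus_opp_r, Cmod_0; lra.
  - destruct (IH ltac:(intros; apply H; lia || assumption) (eta / 2)) as [M1 H1]; [lra|].
    destruct (H (S N) ltac:(lia) (eta / 2)) as [M2 H2]; [lra|].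
    exists (Nat.max M1 M2); intros m Hm; rewrite !Csum_S.
    replace (Csum (u m) N + u m (S N) - (Csum l N + l (S N)))%C
      with ((Csum (u m) N - Csum l N) + (u m (S N) - l (S N)))%C by ring.
    eapply Rle_trans; [apply Cmod_triangle|].
    specialize (H1 m ltac:(lia)); specialize (H2 m ltac:(lia)); lra.
Qed.

(** The partial sum operators are bounded uniformly in [N], at the price of a shift.
    Hence the coefficients of the approximating polynomials converge, and the partial
    sums of the limit series are close to those of a polynomial, which are
    eventually the polynomial itself. *)
Lemma uapprox_cvg f :
  uapprox f ->
  exists a, forall eps, 0 < eps -> dirichlet_cvg_unif a (half_plane eps) f.
Proof.
  intros Hf.
  assert (Hinv : forall m : nat, 0 < / INR (S m))
    by (intros; apply Rinv_0_lt_compat, lt_0_INR; lia).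
  assert (Hdecr : forall m M : nat, (M <= m)%nat -> / INR (S m) <= / INR (S M)).
  { intros m M HM; apply Rinv_le_contravar; [apply lt_0_INR; lia | apply le_INR; lia]. }
  assert (Hsmall : forall K eta, 0 < eta -> exists M : nat, K * / INR (S M) < eta).
  { intros K eta Heta; destruct (INR_archimed eta (Rabs K)) as [M HM]; [assumption|].
    exists M; apply Rmult_lt_reg_r with (INR (S M)); [apply lt_0_INR; lia|].
    rewrite Rmult_assoc, Rinv_l, Rmult_1_r by (apply not_0_INR; lia).
    rewrite S_INR; pose proof (Rle_abs K); nra. }
  assert (Hch : forall m : nat, exists p : (nat -> C) * nat,
    (forall n, (snd p < n)%nat -> fst p n = RtoC 0) /\
    (forall s N, (snd p <= N)%nat -> half_plane (/ INR (S m)) s ->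
       Cmod (f s - dirichlet_partial (fst p) N s)%C <= / INR (S m))).
  { intros m; destruct (Hf _ _ (Hinv m) (Hinv m)) as [P [HP H]].
    destruct (dpoly_coefs P HP) as [a [L [H0 HL]]].
    exists (a, L); split; [exact H0|]; simpl; intros s N HN Hs.
    rewrite <- (HL s N HN); now apply H. }
  apply functional_choice in Hch; destruct Hch as [p Hp].
  set (A := fun m => fst (p m)); set (Lm := fun m => snd (p m)).
  assert (HP : forall m s N, (Lm m <= N)%nat -> half_plane (/ INR (S m)) s ->
    Cmod (f s - dirichlet_partial (A m) N s)%C <= / INR (S m)) by (intros; now apply Hp).
  assert (H0 : forall m n, (Lm m < n)%nat -> A m n = RtoC 0) by (intros; now apply Hp).
  clearbody A Lm; clear Hp p.
  assert (Hpart : forall d, 0 < d -> exists K, 0 < K /\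
    forall M m m' N s, (M <= m)%nat -> (M <= m')%nat -> half_plane (/ INR (S M)) s ->
      Cmod (dirichlet_partial (A m) N (s + RtoC d) - dirichlet_partial (A m') N (s + RtoC d))%C
        <= K * / INR (S M)).
  { intros d Hd; destruct (bohr_partial_sums d Hd) as [K [HK HB]].
    exists (K * 2); split; [lra|]; intros M m m' N s Hm Hm' Hs.
    set (L := Nat.max N (Nat.max (Lm m) (Lm m'))).
    assert (Hdiff : forall N s, dirichlet_partial (fun n => A m n - A m' n)%C N s
      = (dirichlet_partial (A m) N s - dirichlet_partial (A m') N s)%C).
    { intros N' s'; rewrite !partial_as_Csum.
      rewrite (Csum_ext _ (fun n => A m n * npow_opp n s' + (- (1)) * (A m' n * npow_opp n s'))%C)
        by (intros; ring).
      rewrite Csum_plus, Csum_scal; ring. }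
    rewrite <- Hdiff, Rmult_assoc; apply (HB _ L); [|unfold L; lia].
    intros y; rewrite Hdiff.
    assert (Hs' : forall k, (M <= k)%nat -> half_plane (/ INR (S k)) (s + Ci * RtoC y)%C).
    { intros k Hk; specialize (Hdecr k M Hk); unfold half_plane in *.
      rewrite re_plus; replace (Re (Ci * RtoC y)%C) with 0 by (simpl; ring); lra. }
    match goal with |- Cmod (?u - ?v)%C <= _ =>
      replace (u - v)%C with ((f (s + Ci * RtoC y) - v) + - (f (s + Ci * RtoC y) - u))%C
        by ring end.
    eapply Rle_trans; [apply Cmod_triangle|]; rewrite Cmod_opp.
    pose proof (HP m (s + Ci * RtoC y)%C L ltac:(unfold L; lia) (Hs' m Hm)).
    pose proof (HP m' (s + Ci * RtoC y)%C L ltac:(unfold L; lia) (Hs' m' Hm')).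
    pose proof (Hdecr m M Hm); pose proof (Hdecr m' M Hm'); lra. }
  assert (Hcoef : forall n, exists l, (1 <= n)%nat -> forall eta, 0 < eta ->
    exists M, forall m, (M <= m)%nat -> Cmod (A m n - l)%C <= eta).
  { intros n; destruct n as [|n]; [exists (RtoC 0); lia|].
    destruct (C_cauchy_cvg (fun m => A m (S n))) as [l Hl]; [|now exists l].
    intros eta Heta; destruct (Hpart 1 Rlt_0_1) as [K [HK HB]].
    set (s := (RtoC 2 + RtoC 1)%C); set (e := Cmod (npow_opp (S n) s)).
    assert (He : 0 < e) by (unfold e; rewrite Cmod_npow; apply exp_pos).
    destruct (Hsmall (2 * K / e) eta Heta) as [M HM]; exists M; intros m m' Hm Hm'.
    assert (H2 : half_plane (/ INR (S M)) (RtoC 2)).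
    { unfold half_plane; simpl Re; specialize (Hdecr M 0%nat ltac:(lia)).
      simpl INR in Hdecr at 2; rewrite Rinv_1 in Hdecr; lra. }
    pose proof (HB M m m' (S n) (RtoC 2) Hm Hm' H2) as E1.
    pose proof (HB M m m' n (RtoC 2) Hm Hm' H2) as E2.
    fold s in E1, E2; rewrite !partial_as_Csum in E1, E2; rewrite !Csum_S in E1.
    apply Rmult_le_reg_r with e; [assumption|].
    unfold e at 1; rewrite <- Cmod_mult.
    apply Rle_trans with (2 * (K * / INR (S M))).
    - match type of E1 with Cmod ?u <= _ => match type of E2 with Cmod ?v <= _ =>
        replace ((A m (S n) - A m' (S n)) * npow_opp (S n) s)%C with (u + - v)%C by ring end end.
      eapply Rle_trans; [apply Cmod_triangle|]; rewrite Cmod_opp; lra.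
    - replace (2 * (K * / INR (S M))) with ((2 * K / e * / INR (S M)) * e)
        by (field; split; [apply not_0_INR; lia | lra]).
      apply Rmult_le_compat_r; lra. }
  apply functional_choice in Hcoef; destruct Hcoef as [a Ha].
  exists a; intros eps Heps e He.
  destruct (Hpart (eps / 2)) as [K [HK HB]]; [lra|].
  destruct (Hsmall 1 (eps / 2)) as [M1 HM1]; [lra|].
  destruct (Hsmall (K + 1) (e / 2)) as [M2 HM2]; [lra|].
  set (M := Nat.max M1 M2).
  assert (HM1' : / INR (S M) < eps / 2)
    by (pose proof (Hdecr M M1 ltac:(unfold M; lia)); lra).
  assert (HM2' : (K + 1) * / INR (S M) < e / 2)
    by (pose proof (Hdecr M M2 ltac:(unfold M; lia)); nra).
  exists (Lm M); intros N HN s Hs; unfold half_plane in Hs.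
  assert (Hlim : exists M', forall m, (M' <= m)%nat ->
    Cmod (dirichlet_partial (A m) N s - dirichlet_partial a N s)%C <= e / 2).
  { rewrite partial_as_Csum.
    apply (Csum_lim (fun m n => A m n * npow_opp n s)%C); [|lra].
    intros n Hn eta Heta; set (x := Cmod (npow_opp n s)).
    assert (Hx : 0 < x) by (unfold x; rewrite Cmod_npow; apply exp_pos).
    destruct (Ha n ltac:(lia) (eta / x)) as [M' HM']; [apply Rdiv_lt_0_compat; lra|].
    exists M'; intros m Hm; specialize (HM' m Hm).
    replace (A m n * npow_opp n s - a n * npow_opp n s)%C
      with ((A m n - a n) * npow_opp n s)%C by ring.
    rewrite Cmod_mult; fold x.
    replace eta with (eta / x * x) by (field; lra).
    apply Rmult_le_compat_r; lra. }
  destruct Hlim as [M' HM']; set (m := Nat.max M M').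
  specialize (HM' m ltac:(unfold m; lia)).
  specialize (HB M m M N (s - RtoC (eps / 2))%C ltac:(unfold m; lia) (le_n M)).
  replace (s - RtoC (eps / 2) + RtoC (eps / 2))%C with s in HB by ring.
  assert (HB' : Cmod (dirichlet_partial (A m) N s - dirichlet_partial (A M) N s)%C
            <= K * / INR (S M)).
  { apply HB; unfold half_plane, Cminus; rewrite re_plus, re_opp, re_RtoC; lra. }
  assert (HPM : Cmod (f s - dirichlet_partial (A M) N s)%C <= / INR (S M))
    by (apply HP; [assumption | unfold half_plane; lra]).
  match goal with |- Cmod (?u - ?v)%C < _ => match type of HB' with Cmod (?x - ?y)%C <= _ =>
    replace (u - v)%C with (- (x - u) + ((x - y) + - (v - y)))%C by ring end end.
  eapply Rle_lt_trans; [apply Cmod_triangle|]; rewrite Cmod_opp.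
  eapply Rle_lt_trans; [apply Rplus_le_compat_l, Cmod_triangle|]; rewrite Cmod_opp.
  lra.
Qed.

(** Existence of the limit in Koenigs' method: the increments of the approximants decrease
    geometrically, at a rate that may degenerate near the boundary. *)
Lemma uapprox_lim (U : nat -> C -> C) :
  (forall N, uapprox (U N)) ->
  (forall eps, 0 < eps -> exists K q, 0 <= K /\ 0 <= q < 1 /\
     forall N s, half_plane eps s -> Cmod (U (S N) s - U N s)%C <= K * q ^ N) ->
  exists theta, uapprox theta /\
    forall s, half_plane 0 s -> forall eta, 0 < eta ->
      exists N0, forall N, (N0 <= N)%nat -> Cmod (U N s - theta s)%C <= eta.
Proof.
  intros HU Hinc.
  (* the telescoped increments form a geometric tail *)
  assert (Htail : forall eps, 0 < eps -> exists K q, 0 <= K /\ 0 <= q < 1 /\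
     forall N k s, half_plane eps s -> Cmod (U (N + k)%nat s - U N s)%C <= K * q ^ N).
  { intros eps He; destruct (Hinc eps He) as [K [q [HK [Hq H]]]].
    exists (K / (1 - q)), q; split; [apply Rmult_le_pos; [lra | left; apply Rinv_0_lt_compat; lra]|].
    split; [assumption|]; intros N k s Hs.
    assert (H' : Cmod (U (N + k)%nat s - U N s)%C <= K / (1 - q) * (q ^ N - q ^ (N + k))).
    { induction k as [|k IH].
      - rewrite Nat.add_0_r, Rminus_diag; unfold Cminus; rewrite Cplus_opp_r, Cmod_0; lra.
      - rewrite Nat.add_succ_r.
        replace (U (S (N + k)) s - U N s)%C
          with ((U (S (N + k)) s - U (N + k)%nat s) + (U (N + k)%nat s - U N s))%C by ring.
        eapply Rle_trans; [apply Cmod_triangle|].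
        specialize (H (N + k)%nat s Hs).
        replace (K / (1 - q) * (q ^ N - q ^ S (N + k)))
          with (K * q ^ (N + k) + K / (1 - q) * (q ^ N - q ^ (N + k)))
          by (simpl; field; lra).
        lra. }
    eapply Rle_trans; [exact H'|].
    apply Rmult_le_compat_l; [apply Rmult_le_pos; [lra | left; apply Rinv_0_lt_compat; lra]|].
    pose proof (pow_le q (N + k)); lra. }
  assert (Hgeo : forall K q eta, 0 <= K -> 0 <= q < 1 -> 0 < eta ->
    exists N0, forall N, (N0 <= N)%nat -> K * q ^ N <= eta).
  { intros K q eta HK Hq Heta.
    destruct (pow_lt_1_zero q ltac:(rewrite Rabs_pos_eq; lra) (eta / (K + 1))) as [N0 HN0];
      [apply Rdiv_lt_0_compat; lra|].
    exists N0; intros N HN; specialize (HN0 N HN).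
    rewrite Rabs_pos_eq in HN0 by (apply pow_le; lra).
    pose proof (pow_le q N ltac:(lra)).
    apply Rle_trans with ((K + 1) * (eta / (K + 1))); [|right; field; lra].
    apply Rmult_le_compat; lra. }
  assert (Hlim : forall s, exists l, half_plane 0 s -> forall eta, 0 < eta ->
      exists N0, forall N, (N0 <= N)%nat -> Cmod (U N s - l)%C <= eta).
  { intros s; destruct (Rlt_dec 0 (Re s)) as [Hs|Hs]; [|exists (RtoC 0); intros; contradiction].
    destruct (C_cauchy_cvg (fun N => U N s)) as [l Hl]; [|now exists l].
    destruct (Htail (Re s / 2)) as [K [q [HK [Hq H]]]]; [lra|].
    intros eta Heta; destruct (Hgeo K q (eta / 2)) as [N0 HN0]; try assumption; [lra|].
    exists N0; intros m m' Hm Hm'.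
    replace (U m s - U m' s)%C with ((U m s - U N0 s) + - (U m' s - U N0 s))%C by ring.
    eapply Rle_trans; [apply Cmod_triangle|]; rewrite Cmod_opp.
    assert (Hh : half_plane (Re s / 2) s) by (unfold half_plane; lra).
    pose proof (H N0 (m - N0)%nat s Hh) as E1; pose proof (H N0 (m' - N0)%nat s Hh) as E2.
    replace (N0 + (m - N0))%nat with m in E1 by lia.
    replace (N0 + (m' - N0))%nat with m' in E2 by lia.
    specialize (HN0 N0 (le_n _)); lra. }
  apply functional_choice in Hlim; destruct Hlim as [theta Hth].
  exists theta; split; [|exact Hth].
  apply uapprox_closed; intros eps eta He Heta.
  destruct (Htail eps He) as [K [q [HK [Hq H]]]].
  destruct (Hgeo K q (eta / 2)) as [N0 HN0]; try assumption; [lra|].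
  exists (U N0); split; [apply HU|]; intros s Hs.
  destruct (Hth s ltac:(unfold half_plane in *; lra) (eta / 2)) as [N1 HN1]; [lra|].
  specialize (HN1 (N0 + N1)%nat ltac:(lia)); specialize (H N0 N1 s Hs).
  specialize (HN0 N0 (le_n _)).
  replace (theta s - U N0 s)%C
    with ((U (N0 + N1)%nat s - U N0 s) + - (U (N0 + N1)%nat s - theta s))%C by ring.
  eapply Rle_trans; [apply Cmod_triangle|]; rewrite Cmod_opp; lra.
Qed.

(** * A Harnack inequality *)

Lemma tri_ln j n :
  (2 <= j)%nat -> (1 <= n)%nat ->
  ln (INR j) * tri (ln (INR j)) (ln (INR n))
  = if (n <=? j)%nat then ln (INR j) - ln (INR n) else 0.
Proof.
  intros Hj Hn; unfold tri.
  assert (Hpos : 0 < ln (INR j)) by (rewrite <- ln_1; apply (ln_INR_lt 1 j); lia).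
  pose proof (ln_INR_nonneg n).
  rewrite (Rabs_pos_eq (_ + _)), (Rabs_pos_eq (ln (INR n))) by lra.
  destruct (Nat.leb_spec n j) as [H1|H1].
  - assert (ln (INR n) <= ln (INR j)) by (apply ln_INR_le; lia).
    rewrite Rabs_left1 by lra; field; lra.
  - assert (ln (INR j) < ln (INR n)) by (apply ln_INR_lt; lia).
    rewrite Rabs_pos_eq by lra; field; lra.
Qed.

Lemma Rsum_truncate f K N :
  (K <= N)%nat ->
  Rsum (fun n => if (n <=? K)%nat then f n else 0) N = Rsum f K.
Proof.
  intros H; induction N as [|N IH].
  - now replace K with 0%nat by lia; rewrite !Rsum_0.
  - rewrite Rsum_S; destruct (Nat.eq_dec K (S N)) as [->|Hne].
    + rewrite Rsum_S, Nat.leb_refl; f_equal.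
      apply Rsum_ext; intros n Hn.
      now rewrite (proj2 (Nat.leb_le n (S N))) by lia.
    + rewrite IH by lia.
      rewrite (proj2 (Nat.leb_gt (S N) K)) by lia; ring.
Qed.

(** The slope of the chord of the convex function [exp (- d x)] between [ln k] and
    [ln (k + 1)]. *)
Definition slope (d : R) (k : nat) : R :=
  (exp (- (d * ln (INR (S k)))) - exp (- (d * ln (INR k))))
  / (ln (INR (S k)) - ln (INR k)).

Lemma slope_bounds d k :
  0 < d -> (1 <= k)%nat ->
  - d * exp (- (d * ln (INR k))) < slope d k < - d * exp (- (d * ln (INR (S k)))).
Proof.
  intros Hd Hk; unfold slope.
  pose proof (ln_INR_lt k (S k) Hk ltac:(lia)) as Hlt.
  set (x := ln (INR k)) in *; set (y := ln (INR (S k))) in *.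
  assert (Hx : exp (- (d * y)) = exp (- (d * x)) * exp (- (d * (y - x))))
    by (rewrite <- exp_plus; f_equal; ring).
  assert (Hy : exp (- (d * x)) = exp (- (d * y)) * exp (d * (y - x)))
    by (rewrite <- exp_plus; f_equal; ring).
  assert (Hdd : 0 < d * (y - x)) by nra.
  pose proof (exp_ineq1 (- (d * (y - x))) ltac:(lra)).
  pose proof (exp_ineq1 (d * (y - x)) ltac:(lra)).
  pose proof (exp_pos (- (d * x))); pose proof (exp_pos (- (d * y))).
  split; apply Rmult_lt_reg_r with (y - x); try lra;
    replace ((exp (- (d * y)) - exp (- (d * x))) / (y - x) * (y - x))
      with (exp (- (d * y)) - exp (- (d * x))) by (field; lra).
  - rewrite Hx at 1; nra.
  - rewrite Hy at 1; nra.
Qed.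

(** Summing twice by parts writes the Dirichlet polynomial at [s + d] as a combination of
    its Riesz means at [s], whose coefficients are nonnegative because [exp (- d x)] is
    convex. The Riesz means are averages of translates of the polynomial, and the
    one of index 2 reduces to the constant coefficient. *)
Lemma riesz_lower_bound d (x : nat -> R) (L : nat) :
  0 < d -> (3 <= L)%nat ->
  (forall j, (2 <= j <= L)%nat -> 0 <= Rsum (fun n => (ln (INR j) - ln (INR n)) * x n) j) ->
  0 <= Rsum x L ->
  (slope d 2 - slope d 1) * (ln 2 * x 1%nat)
    <= Rsum (fun n => exp (- (d * ln (INR n))) * x n) L.
Proof.
  intros Hd HL HR HS.
  set (e := fun n => exp (- (d * ln (INR n)))).
  set (Rz := fun j => Rsum (fun n => (ln (INR j) - ln (INR n)) * x n) j).
  change (forall j, (2 <= j <= L)%nat -> 0 <= Rz j) in HR.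
  assert (HRz : forall j, Rz (S j) = Rz j + (ln (INR (S j)) - ln (INR j)) * Rsum x j).
  { intros j; unfold Rz; rewrite Rsum_S, <- Rsum_scal, Rminus_diag, Rmult_0_l, Rplus_0_r.
    rewrite <- Rsum_plus; apply Rsum_ext; intros; ring. }
  assert (Hsl : forall k, (1 <= k)%nat ->
    e (S k) - e k = slope d k * (ln (INR (S k)) - ln (INR k))).
  { intros k Hk; pose proof (ln_INR_lt k (S k) Hk ltac:(lia)).
    unfold slope, e; field; lra. }
  set (E := fun k => Rsum (fun n => e n * x n) (S k) - e (S k) * Rsum x (S k)
              + slope d k * Rz (S k)).
  assert (Hstep : forall k, (1 <= k)%nat ->
    E (S k) = E k + (slope d (S k) - slope d k) * Rz (S k)).
  { intros k Hk; unfold E; rewrite (Rsum_S _ (S k)), (Rsum_S x (S k)), (HRz (S k)).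
    specialize (Hsl (S k) ltac:(lia)).
    replace (e (S (S k))) with (e (S k) + slope d (S k) * (ln (INR (S (S k))) - ln (INR (S k))))
      by lra.
    ring. }
  assert (Hz1 : Rz 1%nat = 0) by (unfold Rz; rewrite Rsum_S, Rsum_0; ring).
  assert (Hs1 : Rsum x 1 = x 1%nat) by (rewrite Rsum_S, Rsum_0; ring).
  assert (Hz2 : Rz 2%nat = ln 2 * x 1%nat).
  { rewrite HRz, Hz1, Hs1; change (INR 1) with 1; change (INR 2) with 2; rewrite ln_1; ring. }
  assert (HE1 : E 1%nat = 0).
  { unfold E; rewrite (HRz 1%nat), Hz1, !(Rsum_S _ 1), !Hs1, Rsum_S, Rsum_0.
    specialize (Hsl 1%nat (le_n _)).
    replace (e 2%nat) with (e 1%nat + slope d 1 * (ln (INR 2) - ln (INR 1))) by lra; ring. }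
  assert (Hmono : forall k, (1 <= k)%nat -> slope d k <= slope d (S k)).
  { intros k Hk; pose proof (slope_bounds d k Hd Hk).
    pose proof (slope_bounds d (S k) Hd ltac:(lia)); lra. }
  assert (HE : forall k, (2 <= k)%nat -> (S k <= L)%nat ->
    (slope d 2 - slope d 1) * (ln 2 * x 1%nat) <= E k).
  { intros k Hk; induction Hk as [|k Hk IH]; intros HkL.
    - rewrite Hstep, HE1, Hz2 by lia; lra.
    - rewrite Hstep by lia; specialize (IH ltac:(lia)).
      specialize (Hmono k ltac:(lia)); specialize (HR (S k) ltac:(lia)); nra. }
  destruct L as [|k]; [lia|].
  eapply Rle_trans; [apply (HE k); lia|]; unfold E.
  specialize (HR (S k) ltac:(lia)).
  assert (0 < e (S k)) by apply exp_pos.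
  pose proof (slope_bounds d k Hd ltac:(lia)) as [_ Hneg].
  pose proof (exp_pos (- (d * ln (INR (S k))))).
  assert (slope d k <= 0) by nra.
  change (Rsum (fun n => exp (- (d * ln (INR n))) * x n) (S k))
    with (Rsum (fun n => e n * x n) (S k)).
  nra.
Qed.

Lemma harnack_dpoly d :
  0 < d ->
  exists nu, 0 < nu /\
    forall (a : nat -> C) (L : nat) (s : C), (3 <= L)%nat ->
      (forall y : R, 0 <= Re (dirichlet_partial a L (s + Ci * RtoC y)%C)) ->
      nu * Re (a 1%nat) <= Re (dirichlet_partial a L (s + RtoC d)%C).
Proof.
  intros Hd; exists ((slope d 2 - slope d 1) * ln 2); split.
  { pose proof (slope_bounds d 1 Hd (le_n _)); pose proof (slope_bounds d 2 Hd ltac:(lia)).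
    pose proof ln_lt_2; apply Rmult_lt_0_compat; lra. }
  intros a L s HL H.
  set (b := fun n => (a n * npow_opp n s)%C).
  assert (HV : forall y, 0 <= Re (vert b L y))
    by (intros y; unfold b; rewrite <- partial_vert; apply H).
  replace (Re (a 1%nat)) with (Re (b 1%nat)) by (unfold b; rewrite npow_1; f_equal; ring).
  rewrite partial_as_Csum, Re_Csum.
  rewrite (Rsum_ext _ (fun n => exp (- (d * ln (INR n))) * Re (b n))).
  2: { intros n _; unfold b; rewrite npow_plus, npow_real, Cmult_assoc, re_scal_r; ring. }
  rewrite Rmult_assoc; apply (riesz_lower_bound d (fun n => Re (b n))); try assumption.
  - intros j Hj.
    assert (Hl : 0 < ln (INR j)) by (rewrite <- ln_1; apply (ln_INR_lt 1 j); lia).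
    pose proof (tri_positive (ln (INR j)) b L Hl HV) as HT.
    apply (Rmult_le_compat_l (ln (INR j))) in HT; [|lra].
    rewrite Rmult_0_r, <- Rsum_scal in HT.
    rewrite <- (Rsum_truncate _ j L) by lia.
    erewrite Rsum_ext; [exact HT|]; intros n Hn; cbv beta.
    rewrite <- Rmult_assoc, tri_ln by lia; destruct (n <=? j)%nat; ring.
  - specialize (HV 0); now rewrite vert_0, Re_Csum in HV.
Qed.

(** The partial sums may have a negative real part, but a small constant makes up for it on
    [Re s > eps / 2]; the remaining half of [eps] serves as the shift in the inequality for
    polynomials. *)
Lemma harnack_dirichlet c psi eps :
  (forall eps, 0 < eps -> dirichlet_cvg_unif c (half_plane eps) psi) ->
  (forall s, half_plane 0 s -> 0 <= Re (psi s)) ->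
  0 < eps ->
  exists nu, 0 < nu /\
    forall s, half_plane eps s -> nu * Re (c 1%nat) <= Re (psi s).
Proof.
  intros Hc Hpos He; destruct (harnack_dpoly (eps / 2)) as [nu [Hnu H]]; [lra|].
  exists nu; split; [assumption|]; intros s Hs; unfold half_plane in Hs.
  apply Rle_plus_epsilon; intros eta Heta.
  destruct (Hc (eps / 2) ltac:(lra) (eta / 2)) as [N0 HN0]; [lra|].
  set (N := Nat.max 3 N0); specialize (HN0 N ltac:(lia)).
  (* adding [eta / 2] to the constant coefficient makes the real part nonnegative *)
  set (a := fun n => if (n =? 1)%nat then (c n + RtoC (eta / 2))%C else c n).
  assert (Ha : forall z, dirichlet_partial a N z
                 = (dirichlet_partial c N z + RtoC (eta / 2))%C).
  { intros z; rewrite !partial_as_Csum; assert (HN : (1 <= N)%nat) by lia; clear -HN.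
    induction HN as [|N HN IH].
    - rewrite !Csum_S, !Csum_0, npow_1; unfold a; simpl; ring.
    - rewrite !(Csum_S _ N), IH; unfold a at 1.
      rewrite (proj2 (Nat.eqb_neq (S N) 1)) by lia; ring. }
  specialize (H a N (s - RtoC (eps / 2))%C ltac:(lia)).
  replace (s - RtoC (eps / 2) + RtoC (eps / 2))%C with s in H by ring.
  rewrite Ha, re_plus, re_RtoC in H.
  unfold a at 2 in H; simpl in H.
  assert (H1 : forall z, half_plane (eps / 2) z ->
    Rabs (Re (dirichlet_partial c N z) - Re (psi z)) <= eta / 2).
  { intros z Hz; specialize (HN0 z Hz).

    pose proof (re_le_Cmod (dirichlet_partial c N z - psi z)%C) as HR.
    unfold Cminus at 1 in HR; rewrite re_plus, re_opp in HR; unfold Rminus; lra. }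
  assert (HH : nu * (Re (c 1%nat) + eta / 2) <= Re (dirichlet_partial c N s) + eta / 2).
  { apply H; intros y; rewrite Ha, re_plus, re_RtoC.
    set (z := (s - RtoC (eps / 2) + Ci * RtoC y)%C).
    assert (Hz : half_plane (eps / 2) z).
    { unfold half_plane, z, Cminus; rewrite !re_plus, re_opp, re_RtoC.
      replace (Re (Ci * RtoC y)%C) with 0 by (simpl; ring); lra. }
    specialize (H1 z Hz); apply Rabs_le_between in H1.
    specialize (Hpos z ltac:(unfold half_plane in *; lra)); lra. }
  specialize (H1 s ltac:(unfold half_plane; lra)); apply Rabs_le_between in H1.
  nra.
Qed.

(** * The half-plane of absolute convergence *)

Lemma sq_sum_tail (w : nat -> C) (D : R) (k N : nat) :
  0 <= D -> (1 <= k <= N)%nat ->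
  (forall n, (k < n)%nat -> Cmod (w n) <= D * / INR n ^ 2) ->
  Cmod (Csum w N - Csum w k)%C <= D * / INR k.
Proof.
  intros HD [Hk HN] H.
  enough (Cmod (Csum w N - Csum w k)%C <= D * (/ INR k - / INR N)).
  { assert (0 < / INR N) by (apply Rinv_0_lt_compat, lt_0_INR; lia); nra. }
  induction HN as [|N HN IH].
  - unfold Cminus; rewrite Cplus_opp_r, Cmod_0; lra.
  - rewrite Csum_S.
    replace (Csum w N + w (S N) - Csum w k)%C with ((Csum w N - Csum w k) + w (S N))%C by ring.
    eapply Rle_trans; [apply Cmod_triangle|]; specialize (H (S N) ltac:(lia)).
    assert (H1 : 0 < INR N) by (apply lt_0_INR; lia).
    assert (/ INR (S N) ^ 2 <= / INR N - / INR (S N)).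
    { rewrite S_INR.
      replace (/ INR N - / (INR N + 1)) with (/ (INR N * (INR N + 1))) by (field; lra).
      apply Rinv_le_contravar; nra. }
    nra.
Qed.

Lemma inv_sq_exp n : (1 <= n)%nat -> / INR n ^ 2 = exp (- (2 * ln (INR n))).
Proof.
  intros Hn; rewrite exp_Ropp; f_equal.
  change 2 with (INR 2); rewrite exp_INR_mult, exp_ln; [reflexivity | apply lt_0_INR; lia].
Qed.

Lemma dirichlet_coef_bound a f :
  dirichlet_cvg_unif a (half_plane (1 / 2)) f ->
  exists B, 0 <= B /\ forall n, (1 <= n)%nat -> Cmod (a n) <= B * INR n.
Proof.
  intros H; destruct (H 1 Rlt_0_1) as [N0 HN0].
  exists (2 + Rsum (fun n => Cmod (a n)) N0).
  assert (Hsum : forall N n, (1 <= n <= N)%nat -> Cmod (a n) <= Rsum (fun n => Cmod (a n)) N).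
  { induction N as [|N IH]; intros n Hn; [lia|]; rewrite Rsum_S.
    destruct (Nat.eq_dec n (S N)) as [->|].
    - pose proof (Rsum_nonneg (fun n => Cmod (a n)) N (fun n _ => Cmod_ge_0 (a n))); lra.
    - specialize (IH n ltac:(lia)); pose proof (Cmod_ge_0 (a (S N))); lra. }
  pose proof (Rsum_nonneg (fun n => Cmod (a n)) N0 (fun n _ => Cmod_ge_0 (a n))) as H0.
  split; [lra|]; intros n Hn.
  assert (H1 : 1 <= INR n) by now apply (le_INR 1).
  destruct (Nat.le_gt_cases n N0) as [Hle|Hgt].
  - specialize (Hsum N0 n ltac:(lia)); nra.
  - destruct n as [|n]; [lia|].
    assert (Hs : half_plane (1 / 2) (RtoC 1)) by (unfold half_plane; rewrite re_RtoC; lra).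
    pose proof (HN0 n ltac:(lia) _ Hs) as E1; pose proof (HN0 (S n) ltac:(lia) _ Hs) as E2.
    rewrite partial_as_Csum in E1, E2; rewrite Csum_S in E2.
    match type of E1 with Cmod ?u < _ => match type of E2 with Cmod ?v < _ =>
      assert (E3 : Cmod (v + - u)%C <= 2)
        by (eapply Rle_trans; [apply Cmod_triangle|]; rewrite Cmod_opp; lra);
      replace (v + - u)%C with (a (S n) * npow_opp (S n) (RtoC 1))%C in E3 by ring end end.
    rewrite Cmod_mult, Cmod_npow, re_RtoC, Rmult_1_l, exp_Ropp, exp_ln in E3 by lra.
    apply (Rmult_le_compat_r (INR (S n))) in E3; [|lra].
    rewrite Rmult_assoc, Rinv_l in E3 by lra; nra.
Qed.

Lemma dirichlet_cvg_point a eps f s eta :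
  dirichlet_cvg_unif a (half_plane eps) f -> half_plane eps s -> 0 < eta ->
  exists N0, forall N, (N0 <= N)%nat -> Cmod (dirichlet_partial a N s - f s)%C <= eta.
Proof.
  intros H Hs Heta; destruct (H eta Heta) as [N0 HN0]; exists N0; intros N HN.
  left; now apply HN0.
Qed.

(** The coefficients being [O(n)], two more powers of [n] make the series absolutely
    convergent, whence the shift by [3]. *)
Lemma dirichlet_tail a f :
  dirichlet_cvg_unif a (half_plane (1 / 2)) f ->
  exists B, 0 <= B /\ forall (k : nat) (s : C), (1 <= k)%nat -> 3 <= Re s ->
    Cmod (f s - dirichlet_partial a k s)%C <= B * exp (- ((Re s - 3) * ln (INR (S k)))).
Proof.
  intros H; destruct (dirichlet_coef_bound a f H) as [B [HB Ha]].
  exists B; split; [assumption|]; intros k s Hk Hs.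
  apply Rle_plus_epsilon; intros eta Heta.
  destruct (dirichlet_cvg_point a _ f s eta H) as [N0 HN0];
    [unfold half_plane; lra | assumption|].
  set (N := Nat.max k N0); specialize (HN0 N ltac:(lia)).
  set (h := exp (- ((Re s - 3) * ln (INR (S k))))).
  assert (Hh : 0 < h) by apply exp_pos.
  assert (HT : Cmod (dirichlet_partial a N s - dirichlet_partial a k s)%C <= B * h).
  { rewrite !partial_as_Csum; eapply Rle_trans;
      [apply (sq_sum_tail _ (B * h)); [nra | lia|] |].
    - intros n Hn; rewrite Cmod_mult, Cmod_npow, inv_sq_exp by lia.
      assert (Hn0 : 0 < INR n) by (apply lt_0_INR; lia).
      apply Rle_trans with (B * INR n * exp (- (Re s * ln (INR n)))).
      + apply Rmult_le_compat_r; [left; apply exp_pos | apply Ha; lia].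
      + rewrite !Rmult_assoc; apply Rmult_le_compat_l; [assumption|].
        rewrite <- (exp_ln (INR n)) at 1 by assumption.
        unfold h; rewrite <- !exp_plus; apply exp_le_exp.
        pose proof (ln_INR_le (S k) n ltac:(lia) ltac:(lia)); nra.
    - assert (/ INR k <= 1).
      { rewrite <- Rinv_1; apply Rinv_le_contravar; [lra | now apply (le_INR 1)]. }
      assert (0 <= B * h) by nra; nra. }
  match goal with |- Cmod (?u - ?v)%C <= _ => match type of HN0 with Cmod (?x - _)%C <= _ =>
    replace (u - v)%C with ((x - v) + - (x - u))%C by ring end end.
  eapply Rle_trans; [apply Cmod_triangle|]; rewrite Cmod_opp; lra.
Qed.

(** The constant term disappears from the difference, and the Lipschitz constants of all
    the others tend to zero as [R0] tends to infinity. *)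
Lemma dirichlet_lipschitz a f :
  dirichlet_cvg_unif a (half_plane (1 / 2)) f ->
  exists R0, 4 <= R0 /\ forall s t, half_plane R0 s -> half_plane R0 t ->
    Cmod (f s - f t)%C <= / 2 * Cmod (s - t)%C.
Proof.
  intros H; destruct (dirichlet_coef_bound a f H) as [B [HB Ha]].
  pose proof ln_lt_2 as Hln2.
  set (R0 := 4 + 6 * B / ln 2).
  assert (HR0 : 4 <= R0).
  { assert (0 <= 6 * B / ln 2)
      by (apply Rmult_le_pos; [lra | left; apply Rinv_0_lt_compat; lra]); unfold R0; lra. }
  exists R0; split; [assumption|]; intros s t Hs Ht; unfold half_plane in Hs, Ht.
  apply Rle_plus_epsilon; intros eta Heta.
  destruct (dirichlet_cvg_point a _ f s (eta / 2) H) as [N1 HN1];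
    [unfold half_plane; lra | lra|].
  destruct (dirichlet_cvg_point a _ f t (eta / 2) H) as [N2 HN2];
    [unfold half_plane; lra | lra|].
  set (N := S (Nat.max N1 N2)); specialize (HN1 N ltac:(lia)); specialize (HN2 N ltac:(lia)).
  set (h := exp (- ((R0 - 4) * ln 2))).
  assert (Hh : 6 * B * h <= 1).
  { unfold h, R0; replace ((4 + 6 * B / ln 2 - 4) * ln 2) with (6 * B) by (field; lra).
    rewrite exp_Ropp; pose proof (exp_ineq1_le (6 * B)); pose proof (exp_pos (6 * B)).
    apply Rmult_le_reg_r with (exp (6 * B)); [assumption|].
    rewrite Rmult_assoc, Rinv_l by lra; lra. }
  assert (Hh0 : 0 < h) by apply exp_pos.
  assert (HT : Cmod (dirichlet_partial a N s - dirichlet_partial a N t)%C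
            <= / 2 * Cmod (s - t)%C).
  { pose proof (Cmod_ge_0 (s - t)%C) as Hst.
    set (w := fun n => (a n * (npow_opp n s - npow_opp n t))%C).
    replace (dirichlet_partial a N s - dirichlet_partial a N t)%C with (Csum w N - Csum w 1)%C.
    2: { rewrite !(Csum_S _ 0), !Csum_0; unfold w at 2; rewrite !npow_1, !partial_as_Csum.
         rewrite (Csum_ext w (fun n => a n * npow_opp n s + (- (1)) * (a n * npow_opp n t))%C)
           by (intros; unfold w; ring).
         rewrite Csum_plus, Csum_scal; ring. }
    eapply Rle_trans; [apply (sq_sum_tail _ (3 * B * h * Cmod (s - t)%C)); [| lia |]|].
    - apply Rmult_le_pos; nra.
    - intros n Hn; unfold w; rewrite Cmod_mult, inv_sq_exp by lia.
      assert (Hn0 : 0 < INR n) by (apply lt_0_INR; lia).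
      pose proof (npow_lipschitz n R0 s t ltac:(lra) ltac:(lra)) as HL.
      pose proof (ln_INR_le_INR n ltac:(lia)) as Hln; pose proof (ln_INR_nonneg n).
      apply Rle_trans with
        (B * INR n * (3 * INR n * exp (- (R0 * ln (INR n))) * Cmod (s - t)%C)).
      + apply Rmult_le_compat; try apply Cmod_ge_0; [apply Ha; lia|].
        eapply Rle_trans; [exact HL|]; apply Rmult_le_compat_r; [assumption|].
        apply Rmult_le_compat_r; [left; apply exp_pos | lra].
      + replace (B * INR n * (3 * INR n * exp (- (R0 * ln (INR n))) * Cmod (s - t)%C))
          with (3 * B * Cmod (s - t)%C * (INR n * INR n * exp (- (R0 * ln (INR n))))) by ring.
        replace (3 * B * h * Cmod (s - t)%C * exp (- (2 * ln (INR n))))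
          with (3 * B * Cmod (s - t)%C * (h * exp (- (2 * ln (INR n))))) by ring.
        apply Rmult_le_compat_l; [apply Rmult_le_pos; lra|].
        rewrite <- (exp_ln (INR n)) at 1 2 by assumption.
        unfold h; rewrite <- !exp_plus; apply exp_le_exp.
        pose proof (ln_INR_le 2 n ltac:(lia) ltac:(lia)) as H2; change (INR 2) with 2 in H2; nra.
    - simpl; rewrite Rinv_1, Rmult_1_r; nra. }
  match type of HN1 with Cmod (?x - _)%C <= _ => match type of HN2 with Cmod (?y - _)%C <= _ =>
    replace (f s - f t)%C with ((x - y) + (- (x - f s) + (y - f t)))%C by ring end end.
  eapply Rle_trans; [apply Cmod_triangle|].
  eapply Rle_trans; [apply Rplus_le_compat_l, Cmod_triangle|]; rewrite Cmod_opp; lra.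
Qed.

Lemma Cplus_minus_cancel s t : (s + (t - s))%C = t.
Proof. ring. Qed.

Lemma is_derive_of_quadratic (f : C -> C) (s l : C) (K : R) :
  (forall h, Cmod h <= 1 -> Cmod (f (s + h) - f s - h * l)%C <= K * Cmod h ^ 2) ->
  @is_derive C_AbsRing C_NormedModule f s l.
Proof.
  intros H; split; [apply is_linear_scal_l|].
  intros x Hx.
  apply (@is_filter_lim_locally_unique _ (AbsRing_NormedModule C_AbsRing)) in Hx.
  rewrite <- Hx.
  intros eps; set (K' := Rabs K).
  assert (HK : 0 <= K') by apply Rabs_pos.
  pose proof (cond_pos eps) as Heps.
  assert (Hd : 0 < Rmin 1 (eps / (K' + 1)))
    by (apply Rmin_glb_lt; [lra | apply Rdiv_lt_0_compat; lra]).
  exists (mkposreal _ Hd); intros y Hy.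
  change (Cmod (y - s)%C < Rmin 1 (eps / (K' + 1))) in Hy.
  change (Cmod ((f y - f s) - (y - s) * l)%C <= eps * Cmod (y - s)%C).
  pose proof (Rmin_l 1 (eps / (K' + 1))); pose proof (Rmin_r 1 (eps / (K' + 1))).
  specialize (H (y - s)%C ltac:(lra)).
  rewrite Cplus_minus_cancel in H.
  pose proof (Cmod_ge_0 (y - s)%C) as Hm0; set (m := Cmod (y - s)%C) in *.
  pose proof (Rle_abs K) as HKK; fold K' in HKK.
  assert (m * (K' + 1) <= eps).
  { replace (pos eps) with (eps / (K' + 1) * (K' + 1)) by (field; lra).
    apply Rmult_le_compat_r; lra. }
  eapply Rle_trans; [exact H|]; nra.
Qed.

(** Differentiation term by term: the second-order remainders of the terms are dominated
    by [|h| ^ 2 / n ^ 2]. *)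
Lemma dirichlet_derivable_far a f s :
  dirichlet_cvg_unif a (half_plane (1 / 2)) f -> 8 <= Re s ->
  @ex_derive C_AbsRing C_NormedModule f s.
Proof.
  intros H Hs; destruct (dirichlet_coef_bound a f H) as [B [HB Ha]].
  set (v := fun n => (a n * (RtoC (- ln (INR n)) * npow_opp n s))%C).
  assert (Hexp : forall n p q, (1 <= n)%nat -> p + q + 2 <= Re s ->
    INR n ^ 2 * exp (p * ln (INR n)) * exp (- (Re s * ln (INR n)))
      <= exp (- (q * ln (INR n)))).
  { intros n p q Hn Hpq.
    assert (Hn0 : 0 < INR n) by (apply lt_0_INR; lia).
    replace (INR n ^ 2) with (exp (2 * ln (INR n)))
      by (change 2 with (INR 2) at 1; now rewrite exp_INR_mult, exp_ln).
    rewrite <- !exp_plus; apply exp_le_exp; pose proof (ln_INR_nonneg n); nra. }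
  destruct (C_cauchy_cvg (Csum v)) as [g Hg].
  { intros eta Heta; destruct (INR_archimed eta (2 * B)) as [M HM]; [assumption|].
    exists (S M).
    assert (HT : forall m, (S M <= m)%nat -> Cmod (Csum v m - Csum v (S M))%C <= eta / 2).
    { intros m Hm; eapply Rle_trans; [apply (sq_sum_tail v B); [assumption | lia|]|].
      - intros n Hn; unfold v; rewrite !Cmod_mult, Cmod_R, Rabs_Ropp, Cmod_npow, inv_sq_exp by lia.
        rewrite Rabs_pos_eq by apply ln_INR_nonneg.
        pose proof (ln_INR_le_INR n ltac:(lia)); pose proof (ln_INR_nonneg n).
        pose proof (exp_pos (- (Re s * ln (INR n)))).
        apply Rle_trans with (B * INR n * (INR n * exp (- (Re s * ln (INR n))))).
        + apply Rmult_le_compat; try apply Cmod_ge_0; [nra | apply Ha; lia|].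
          apply Rmult_le_compat_r; lra.
        + rewrite Rmult_assoc; apply Rmult_le_compat_l; [assumption|].
          specialize (Hexp n 0 2 ltac:(lia) ltac:(lra)).
          rewrite Rmult_0_l, exp_0 in Hexp; nra.
      - assert (HM0 : 0 < INR (S M)) by (apply lt_0_INR; lia).
        apply Rmult_le_reg_r with (INR (S M)); [assumption|].
        rewrite Rmult_assoc, Rinv_l, Rmult_1_r by lra; rewrite S_INR; nra. }
    intros m m' Hm Hm'.
    replace (Csum v m - Csum v m')%C
      with ((Csum v m - Csum v (S M)) + - (Csum v m' - Csum v (S M)))%C by ring.
    eapply Rle_trans; [apply Cmod_triangle|]; rewrite Cmod_opp.
    pose proof (HT m Hm); pose proof (HT m' Hm'); lra. }
  exists g; apply (is_derive_of_quadratic f s g (3 * B)); intros h Hh.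
  pose proof (Cmod_ge_0 h) as Hh0.
  assert (Hsh : 1 / 2 < Re (s + h)%C)
    by (rewrite re_plus; pose proof (Re_ge_Cmod h); lra).
  apply Rle_plus_epsilon; intros eta Heta.
  destruct (dirichlet_cvg_point a _ f s (eta / 3) H) as [N1 HN1];
    [unfold half_plane; lra | lra|].
  destruct (dirichlet_cvg_point a _ f (s + h)%C (eta / 3) H) as [N2 HN2];
    [exact Hsh | lra|].
  destruct (Hg (eta / 3)) as [N3 HN3]; [lra|].
  set (N := S (Nat.max N1 (Nat.max N2 N3))).
  specialize (HN1 N ltac:(lia)); specialize (HN2 N ltac:(lia)); specialize (HN3 N ltac:(lia)).
  set (w := fun n => (a n * npow_opp n s
    * (npow_opp n h - 1 - - (h * RtoC (ln (INR n)))))%C).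
  assert (HT : Cmod (dirichlet_partial a N (s + h) - dirichlet_partial a N s - h * Csum v N)%C
            <= 3 * B * Cmod h ^ 2).
  { replace (dirichlet_partial a N (s + h) - dirichlet_partial a N s - h * Csum v N)%C
      with (Csum w N - Csum w 1)%C.
    2: { rewrite (Csum_S w 0), !Csum_0; unfold w at 2; rewrite !npow_1, !partial_as_Csum.
         simpl INR; rewrite ln_1.
         rewrite (Csum_ext w (fun n => a n * npow_opp n (s + h)
            + ((- (1)) * (a n * npow_opp n s) + (- h) * v n))%C).
         - rewrite !Csum_plus, !Csum_scal; ring.
         - intros n _; unfold w, v; rewrite npow_plus, RtoC_opp; ring. }
    eapply Rle_trans; [apply (sq_sum_tail _ (3 * B * Cmod h ^ 2)); [nra | lia |]|].
    - intros n Hn; unfold w; rewrite !Cmod_mult, Cmod_npow, inv_sq_exp by lia.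
      pose proof (ln_INR_le_INR n ltac:(lia)); pose proof (ln_INR_nonneg n) as Hl.
      pose proof (exp_pos (- (Re s * ln (INR n)))).
      assert (HE : Cmod (npow_opp n h - 1 - - (h * RtoC (ln (INR n))))%C
        <= 3 * (Cmod h ^ 2 * INR n ^ 2) * exp (1 * ln (INR n))).
      { unfold npow_opp; eapply Rle_trans; [apply Cexp_taylor_1|].
        rewrite Cmod_opp, Cmod_mult, Cmod_R, (Rabs_pos_eq _ Hl).
        apply Rmult_le_compat; [|left; apply exp_pos| |apply exp_le_exp; nra].
        - pose proof (pow2_ge_0 (Cmod h * ln (INR n))); lra.
        - apply Rmult_le_compat_l; [lra|]; rewrite <- Rpow_mult_distr.
          apply pow_incr; split; [nra|]; apply Rmult_le_compat_l; assumption. }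
      apply Rle_trans with (B * INR n * exp (- (Re s * ln (INR n)))
         * (3 * (Cmod h ^ 2 * INR n ^ 2) * exp (1 * ln (INR n)))).
      + apply Rmult_le_compat; try apply Cmod_ge_0; try assumption.
        * apply Rmult_le_pos; [apply Cmod_ge_0 | lra].
        * apply Rmult_le_compat_r; [lra | apply Ha; lia].
      + assert (Hn0 : 0 < INR n) by (apply lt_0_INR; lia).
        replace (INR n) with (exp (ln (INR n))) at 1 by now apply exp_ln.
        replace (B * exp (ln (INR n)) * exp (- (Re s * ln (INR n)))
         * (3 * (Cmod h ^ 2 * INR n ^ 2) * exp (1 * ln (INR n))))
          with (3 * B * Cmod h ^ 2 * (INR n ^ 2 * (exp (ln (INR n)) * exp (1 * ln (INR n)))
             * exp (- (Re s * ln (INR n))))) by ring.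
        apply Rmult_le_compat_l; [nra|].
        specialize (Hexp n 2 2 ltac:(lia) ltac:(lra)).
        rewrite <- exp_plus; replace (ln (INR n) + 1 * ln (INR n)) with (2 * ln (INR n)) by ring.
        assumption.
    - simpl (INR 1); rewrite Rinv_1; lra. }
  match type of HT with Cmod ?T <= _ =>
    match type of HN1 with Cmod ?T1 <= _ => match type of HN2 with Cmod ?T2 <= _ =>
    match type of HN3 with Cmod ?T3 <= _ =>
    replace (f (s + h) - f s - h * g)%C with (T + (- T2 + (T1 + h * T3)))%C by ring
    end end end end.
  eapply Rle_trans; [apply Cmod_triangle|].
  eapply Rle_trans; [apply Rplus_le_compat_l, Cmod_triangle|]; rewrite Cmod_opp.
  eapply Rle_trans;
    [apply Rplus_le_compat_l, Rplus_le_compat_l, Cmod_triangle|]; rewrite (Cmod_mult h).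
  match type of HN3 with Cmod ?T3 <= _ => pose proof (Cmod_ge_0 T3) end.
  nra.
Qed.

(** * Behaviour far to the right: constant and leading coefficients *)

Lemma Cmod_eq_of_le z w : (forall eta, 0 < eta -> Cmod (z - w)%C <= eta) -> z = w.
Proof.
  intros H.
  assert (H0 : (z - w)%C = RtoC 0).
  { apply Cmod_eq_0, Rle_antisym; [|apply Cmod_ge_0].
    apply Rle_plus_epsilon; intros eta Heta; specialize (H eta Heta); lra. }
  replace z with ((z - w) + w)%C by ring; rewrite H0; ring.
Qed.

Lemma exp_decay B g eta : 0 <= B -> 0 < g -> 0 < eta ->
  exists X, forall x, X < x -> B * exp (- (g * x)) <= eta.
Proof.
  intros HB Hg Heta; exists (Rmax 0 (B / (g * eta))); intros x Hx.
  pose proof (Rmax_l 0 (B / (g * eta))); pose proof (Rmax_r 0 (B / (g * eta))).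
  rewrite exp_Ropp; pose proof (exp_ineq1_le (g * x)); pose proof (exp_pos (g * x)).
  apply Rmult_le_reg_r with (exp (g * x)); [assumption|].
  rewrite Rmult_assoc, Rinv_l, Rmult_1_r by lra.
  assert (B <= eta * (g * x)); [|nra].
  replace B with (B / (g * eta) * (g * eta)) by (field; lra).
  replace (eta * (g * x)) with (x * (g * eta)) by ring.
  apply Rmult_le_compat_r; [nra | lra].
Qed.

Lemma dirichlet_limit a f eta :
  dirichlet_cvg_unif a (half_plane (1 / 2)) f -> 0 < eta ->
  exists X, 3 <= X /\ forall s, X < Re s -> Cmod (f s - a 1%nat)%C <= eta.
Proof.
  intros H Heta; destruct (dirichlet_tail a f H) as [B [HB HT]].
  pose proof ln_lt_2 as Hl.
  destruct (exp_decay B (ln 2) eta HB ltac:(lra) Heta) as [X HX].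
  exists (Rmax 3 (X + 3)); split; [apply Rmax_l|]; intros s Hs.
  pose proof (Rmax_l 3 (X + 3)); pose proof (Rmax_r 3 (X + 3)).
  specialize (HT 1%nat s (le_n _) ltac:(lra)); specialize (HX (Re s - 3) ltac:(lra)).
  rewrite partial_as_Csum, Csum_S, Csum_0, npow_1 in HT.
  replace (0 + a 1%nat * 1)%C with (a 1%nat) in HT by ring.
  change (INR 2) with 2 in HT; rewrite (Rmult_comm (ln 2)) in HX; lra.
Qed.

Lemma partial_constant a N s :
  (1 <= N)%nat -> (forall n, (2 <= n <= N)%nat -> a n = RtoC 0) ->
  dirichlet_partial a N s = a 1%nat.
Proof.
  intros HN; rewrite partial_as_Csum; induction HN as [|N HN IH]; intros H0.
  - rewrite Csum_S, Csum_0, npow_1; ring.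
  - rewrite Csum_S, IH, (H0 (S N)) by (lia || (intros; apply H0; lia)); ring.
Qed.

Lemma dirichlet_leading a f k eta :
  dirichlet_cvg_unif a (half_plane (1 / 2)) f -> (2 <= k)%nat ->
  (forall n, (2 <= n < k)%nat -> a n = RtoC 0) -> 0 < eta ->
  exists X, 3 <= X /\ forall s, X < Re s ->
    Cmod (f s - (a 1%nat + a k * npow_opp k s))%C <= eta * Cmod (npow_opp k s).
Proof.
  intros H Hk H0 Heta; destruct (dirichlet_tail a f H) as [B [HB HT]].
  pose proof (ln_INR_lt k (S k) ltac:(lia) ltac:(lia)) as Hgap.
  set (x := ln (INR k)) in *; set (y := ln (INR (S k))) in *.
  pose proof (exp_pos (3 * y)).
  destruct (exp_decay (B * exp (3 * y)) (y - x) eta ltac:(nra) ltac:(lra) Heta) as [X HX].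
  exists (Rmax 3 X); split; [apply Rmax_l|]; intros s Hs.
  pose proof (Rmax_l 3 X); pose proof (Rmax_r 3 X).
  specialize (HT k s ltac:(lia) ltac:(lra)); specialize (HX (Re s) ltac:(lra)).
  destruct k as [|k]; [lia|].
  rewrite partial_as_Csum, Csum_S, <- partial_as_Csum, partial_constant in HT
    by (lia || (intros; apply H0; lia)).
  eapply Rle_trans; [exact HT|]; rewrite Cmod_npow; fold x y.
  replace (B * exp (- ((Re s - 3) * y)))
    with ((B * exp (3 * y) * exp (- ((y - x) * Re s))) * exp (- (Re s * x))).
  - apply Rmult_le_compat_r; [left; apply exp_pos | exact HX].
  - rewrite !Rmult_assoc, <- !exp_plus; do 2 f_equal; ring.
Qed.

Lemma dirichlet_constant a f s :
  (forall eps, 0 < eps -> dirichlet_cvg_unif a (half_plane eps) f) ->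
  (forall n, (2 <= n)%nat -> a n = RtoC 0) -> half_plane 0 s -> f s = a 1%nat.
Proof.
  intros H H0 Hs; symmetry; apply Cmod_eq_of_le; intros eta Heta.
  unfold half_plane in Hs.
  destruct (dirichlet_cvg_point a (Re s / 2) f s eta (H (Re s / 2) ltac:(lra)))
    as [N0 HN0]; [unfold half_plane; lra | assumption|].
  specialize (HN0 (S N0) ltac:(lia)); rewrite partial_constant in HN0; try assumption; [lia|].
  intros; apply H0; lia.
Qed.

(** If [Re (c 1)] vanished, the first nonconstant term would dominate far to the right, and
    its real part takes negative values. *)
Lemma constant_coef_positive c psi :
  (forall eps, 0 < eps -> dirichlet_cvg_unif c (half_plane eps) psi) ->
  maps_into (half_plane 0) (half_plane 0) psi -> 0 < Re (c 1%nat).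
Proof.
  intros Hc Hpos; apply Rnot_le_lt; intros Hle.
  assert (Hzero : forall k, (2 <= k)%nat -> c k = RtoC 0).
  { intros k; induction k as [k IH] using (well_founded_induction Wf_nat.lt_wf); intros Hk.
    assert (Hl : 0 < ln (INR k)) by (rewrite <- ln_1; apply (ln_INR_lt 1 k); lia).
    assert (Hturn : forall t, 0 <= Re (c k * npow_opp k (Ci * RtoC t))%C).
    { intros t; apply Rle_plus_epsilon; intros eta Heta.
      destruct (dirichlet_leading c psi k eta (Hc (1 / 2) ltac:(lra)) Hk) as [X [HX3 HX]];
        [intros; apply IH; lia | assumption|].
      set (s := (RtoC (X + 1) + Ci * RtoC t)%C).
      assert (Hs : Re s = X + 1) by (unfold s; simpl; ring).
      specialize (HX s ltac:(lra)).
      specialize (Hpos s ltac:(unfold half_plane; lra)); unfold half_plane in Hpos.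
      pose proof (Re_le_Cmod (psi s - (c 1%nat + c k * npow_opp k s))%C) as HR.
      unfold Cminus in HR; rewrite re_plus, re_opp, re_plus in HR; fold Cminus in HR.
      unfold Cminus in HX.
      assert (Hk1 : Re (c k * npow_opp k s)%C
        = exp (- ((X + 1) * ln (INR k))) * Re (c k * npow_opp k (Ci * RtoC t))%C).
      { unfold s; rewrite npow_plus, npow_real.
        rewrite (Cmult_comm (RtoC _)), Cmult_assoc, re_scal_r; ring. }
      rewrite Cmod_npow, Hs in HX; rewrite Hk1 in HR.
      set (E := exp (- ((X + 1) * ln (INR k)))) in *.
      assert (HE : 0 < E) by apply exp_pos.
      apply Rmult_le_reg_l with E; [assumption | lra]. }
    assert (Hval : forall t, Re (c k * npow_opp k (Ci * RtoC (t / ln (INR k))))%C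
      = Re (c k) * cos t + Im (c k) * sin t).
    { intros t; rewrite npow_imag.
      replace (t / ln (INR k) * ln (INR k)) with t by (field; lra).
      rewrite re_mult; simpl; ring. }
    pose proof (Hturn (0 / ln (INR k))) as H1; pose proof (Hturn (PI / ln (INR k))) as H2.
    pose proof (Hturn (PI / 2 / ln (INR k))) as H3.
    pose proof (Hturn (- (PI / 2) / ln (INR k))) as H4.
    rewrite Hval in H1, H2, H3, H4.
    rewrite cos_0, sin_0 in H1; rewrite cos_PI, sin_PI in H2.
    rewrite cos_PI2, sin_PI2 in H3; rewrite cos_neg, sin_neg, cos_PI2, sin_PI2 in H4.
    destruct (c k) as [x y]; simpl in *; unfold RtoC; f_equal; lra. }
  assert (Hs : half_plane 0 (RtoC 1)) by (unfold half_plane; rewrite re_RtoC; lra).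
  pose proof (Hpos _ Hs) as H1; unfold half_plane in H1.
  rewrite (dirichlet_constant c psi _ Hc Hzero Hs) in H1; lra.
Qed.

Lemma cvg_unif_minus a b f g A :
  dirichlet_cvg_unif a A f -> dirichlet_cvg_unif b A g ->
  dirichlet_cvg_unif (fun n => a n - b n)%C A (fun s => f s - g s)%C.
Proof.
  intros Ha Hb e He; destruct (Ha (e / 2)) as [N1 H1]; [lra|].
  destruct (Hb (e / 2)) as [N2 H2]; [lra|].
  exists (Nat.max N1 N2); intros N HN s Hs.
  specialize (H1 N ltac:(lia) s Hs); specialize (H2 N ltac:(lia) s Hs).
  rewrite partial_as_Csum.
  rewrite (Csum_ext _ (fun n => a n * npow_opp n s + (- (1)) * (b n * npow_opp n s))%C)
    by (intros; ring).
  rewrite Csum_plus, Csum_scal, <- !partial_as_Csum.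
  replace (dirichlet_partial a N s + - (1) * dirichlet_partial b N s - (f s - g s))%C
    with ((dirichlet_partial a N s - f s) + - (dirichlet_partial b N s - g s))%C by ring.
  eapply Rle_lt_trans; [apply Cmod_triangle|]; rewrite Cmod_opp; lra.
Qed.

(** * Holomorphic functions on the right half-plane *)

Lemma open_half_plane theta : @open C_UniformSpace (half_plane theta).
Proof.
  intros x Hx; unfold half_plane in Hx.
  assert (H : 0 < Re x - theta) by lra; exists (mkposreal _ H); intros y [Hy _].
  change (Rabs (Re y - Re x) < Re x - theta) in Hy; apply Rabs_lt_between in Hy.
  unfold half_plane; lra.
Qed.

Lemma holomorphic_ext f g :
  (forall s, half_plane 0 s -> f s = g s) ->
  holomorphic_on (half_plane 0) f -> holomorphic_on (half_plane 0) g.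
Proof.
  intros E H s Hs; apply (ex_derive_ext_loc f); [|now apply H].
  exists (mkposreal _ Hs); intros y Hy; apply E.
  change (Cmod (y - s)%C < Re s) in Hy.
  pose proof (Re_ge_Cmod (y - s)%C) as HR.
  unfold Cminus in HR; rewrite re_plus, re_opp in HR.
  unfold Cminus in Hy; unfold half_plane; lra.
Qed.

Lemma C_derivable_affine A B s :
  @ex_derive C_AbsRing C_NormedModule (fun z => A * z + B)%C s.
Proof.
  exists A; apply (is_derive_of_quadratic _ _ _ 0); intros h _.
  replace (A * (s + h) + B - (A * s + B) - h * A)%C with (RtoC 0) by ring.
  rewrite Cmod_0; lra.
Qed.

Lemma C_derivable_comp f g s :
  @ex_derive C_AbsRing C_NormedModule f (g s) ->
  @ex_derive C_AbsRing C_NormedModule g s ->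
  @ex_derive C_AbsRing C_NormedModule (fun z => f (g z)) s.
Proof.
  intros Hf [l [_ Hd]]; apply (ex_derive_comp f g s Hf).
  (* the two normed module structures of [C] have the same norm *)
  exists l; split; [apply is_linear_scal_l | exact Hd].
Qed.

Lemma C_derivable_plus f g s :
  @ex_derive C_AbsRing C_NormedModule f s ->
  @ex_derive C_AbsRing C_NormedModule g s ->
  @ex_derive C_AbsRing C_NormedModule (fun z => f z + g z)%C s.
Proof. intros Hf Hg; exact (ex_derive_plus f g s Hf Hg). Qed.

(** * Iteration of a map of positive characteristic *)

(** What the two alternatives of the Gordon-Hedenmalm class have in common in positive
    characteristic. *)
Definition symbol (c0 : nat) (c : nat -> C) (psi phi : C -> C) : Prop :=
  (1 <= c0)%nat /\
  (forall s, half_plane 0 s -> phi s = (RtoC (INR c0) * s + psi s)%C) /\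
  holomorphic_on (half_plane 0) psi /\
  (forall eps, 0 < eps -> dirichlet_cvg_unif c (half_plane eps) psi) /\
  (forall s, half_plane 0 s -> 0 <= Re (psi s)).

Lemma gordon_hedenmalm_symbol c0 c psi phi :
  (1 <= c0)%nat -> gordon_hedenmalm c0 c psi phi -> symbol c0 c psi phi.
Proof.
  intros Hc0 [_ [Hphi [[_ [_ [Hhol _]]] [Hc [_ Halt]]]]]; repeat split; try assumption.
  intros s Hs; destruct (Halt Hc0) as [[tau Ht] | Hm].
  - rewrite (Ht s Hs); simpl; lra.
  - left; now apply Hm.
Qed.

Section Iteration.

Variables (c0 : nat) (c : nat -> C) (psi phi : C -> C).
Hypothesis Hsym : symbol c0 c psi phi.

Let it (n : nat) (s : C) : C := Nat.iter n phi s.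

Lemma symbol_uapprox : uapprox psi.
Proof. destruct Hsym as (_ & _ & _ & H & _); now apply (uapprox_of_cvg c). Qed.

Lemma Re_symbol s : half_plane 0 s -> Re (phi s) = INR c0 * Re s + Re (psi s).
Proof.
  destruct Hsym as (_ & Hphi & _); intros Hs.
  now rewrite Hphi, re_plus, re_scal_l.
Qed.

Lemma INR_char_ge_1 : 1 <= INR c0.
Proof. destruct Hsym as [H _]; now apply (le_INR 1). Qed.

Lemma iter_half_plane n eps s : 0 <= eps -> half_plane eps s -> half_plane eps (it n s).
Proof.
  intros He Hs; induction n as [|n IH]; [assumption|].
  unfold half_plane in *; simpl; rewrite Re_symbol by (unfold half_plane; lra).
  destruct Hsym as (_ & _ & _ & _ & Hpos); pose proof INR_char_ge_1.
  specialize (Hpos (it n s) ltac:(unfold half_plane; lra)); fold (it n s); nra.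
Qed.

Lemma Re_iter_ge n s : half_plane 0 s -> INR c0 ^ n * Re s <= Re (it n s).
Proof.
  intros Hs; induction n as [|n IH]; [simpl; lra|].
  pose proof (iter_half_plane n 0 s (Rle_refl _) Hs) as Hn.
  simpl; rewrite Re_symbol by assumption; fold (it n s).
  destruct Hsym as (_ & _ & _ & _ & Hpos); specialize (Hpos _ Hn).
  pose proof INR_char_ge_1; nra.
Qed.

Lemma iter_succ_r n s : it (S n) s = it n (phi s).
Proof. apply Nat.iter_succ_r. Qed.

Lemma uapprox_iter g n : uapprox g -> uapprox (fun s => g (it n s)).
Proof.
  intros Hg; induction n as [|n IH]; [exact Hg|].
  apply (uapprox_ext (fun s => g (it n (phi s)))); [intros; now rewrite iter_succ_r|].
  destruct Hsym as (Hc0 & Hphi & _ & _ & Hpos).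
  apply (uapprox_comp c0 psi phi (fun z => g (it n z))); try assumption.
  apply symbol_uapprox.
Qed.

Lemma iter_holomorphic n : holomorphic_on (half_plane 0) (it n).
Proof.
  induction n as [|n IH].
  - apply (holomorphic_ext (fun z => 1 * z + 0)%C); [intros; simpl; ring|].
    intros s _; apply C_derivable_affine.
  - destruct Hsym as (_ & Hphi & Hhol & _).
    intros s Hs; apply (C_derivable_comp phi (it n)); [|now apply IH].
    apply (holomorphic_ext (fun z => (RtoC (INR c0) * z + 0) + psi z)%C);
      [|intros z Hz; apply C_derivable_plus; [apply C_derivable_affine | now apply Hhol]
       |apply iter_half_plane; [lra | assumption]].
    intros z Hz; rewrite Hphi by assumption; ring.
Qed.

Lemma iter_injective n :
  injective_on (half_plane 0) phi -> injective_on (half_plane 0) (it n).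
Proof.
  intros Hinj; induction n as [|n IH]; intros s t Hs Ht E; [exact E|].
  apply IH; try assumption; apply Hinj; try (apply iter_half_plane; [lra | assumption]).
  exact E.
Qed.

(** The iterates push every point to the right, where a solution is regular: a functional
    equation for the solution transports this regularity back. *)
Definition escapes : Prop :=
  forall s X, half_plane 0 s -> exists n, forall m, (n <= m)%nat -> X < Re (it m s).

Lemma linearizer_holomorphic a theta :
  (forall eps, 0 < eps -> dirichlet_cvg_unif a (half_plane eps) theta) -> escapes ->
  (forall n, exists A B, forall s, half_plane 0 s ->
     (s + theta s)%C = (A * (it n s + theta (it n s)) + B)%C) ->
  holomorphic_on (half_plane 0) theta.
Proof.
  intros Hth Hesc Heq.
  apply (holomorphic_ext (fun s => (s + theta s) + ((- (1)) * s + 0))%C); [intros; ring|].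
  intros s Hs; apply C_derivable_plus; [|apply C_derivable_affine].
  destruct (Hesc s 8 Hs) as [n Hn]; specialize (Hn n (le_n _)).
  destruct (Heq n) as [A [B HAB]]; revert s Hs Hn.
  enough (H : forall s, half_plane 0 s -> 8 < Re (it n s) ->
    @ex_derive C_AbsRing C_NormedModule
      (fun s => A * (it n s + theta (it n s)) + B)%C s).
  { intros s Hs Hn; specialize (H s Hs Hn).
    apply (ex_derive_ext_loc (fun s => A * (it n s + theta (it n s)) + B)%C); [|exact H].
    exists (mkposreal _ Hs); intros y Hy; symmetry; apply HAB.
    change (Cmod (y - s)%C < Re s) in Hy.
    pose proof (Re_ge_Cmod (y - s)%C) as HR.
    unfold Cminus in HR; rewrite re_plus, re_opp in HR.
    unfold Cminus in Hy; unfold half_plane; lra. }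
  intros s Hs Hn.
  apply (C_derivable_comp (fun z => A * z + B)%C (fun s => it n s + theta (it n s))%C);
    [apply C_derivable_affine|].
  apply C_derivable_plus; [now apply iter_holomorphic|].
  apply (C_derivable_comp theta (it n)); [|now apply iter_holomorphic].
  apply (dirichlet_derivable_far a); [apply Hth; lra | lra].
Qed.

Lemma linearizer_injective a theta (T : C -> C) :
  (forall eps, 0 < eps -> dirichlet_cvg_unif a (half_plane eps) theta) -> escapes ->
  (forall s, half_plane 0 s -> (phi s + theta (phi s))%C = T (s + theta s)%C) ->
  injective_on (half_plane 0) phi ->
  injective_on (half_plane 0) (fun s => s + theta s)%C.
Proof.
  intros Hth Hesc Heq Hinj s t Hs Ht E.
  assert (Hit : forall n z, half_plane 0 z ->
    (it n z + theta (it n z))%C = Nat.iter n T (z + theta z)%C).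
  { induction n as [|n IH]; intros z Hz; [reflexivity|].
    simpl; rewrite Heq by (apply iter_half_plane; [lra | assumption]).
    now fold (it n z); rewrite IH. }
  destruct (dirichlet_lipschitz a theta (Hth (1 / 2) ltac:(lra))) as [R0 [HR0 HL]].
  destruct (Hesc s R0 Hs) as [n1 H1], (Hesc t R0 Ht) as [n2 H2].
  set (n := Nat.max n1 n2); specialize (H1 n ltac:(lia)); specialize (H2 n ltac:(lia)).
  apply (iter_injective n Hinj s t Hs Ht).
  assert (E' : (it n s + theta (it n s))%C = (it n t + theta (it n t))%C)
    by (rewrite !Hit, E by assumption; reflexivity).
  specialize (HL _ _ H1 H2).
  apply Cmod_eq_of_le; intros eta Heta.
  replace (theta (it n s) - theta (it n t))%C with (- (it n s - it n t))%C in HL.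
  - rewrite Cmod_opp in HL; pose proof (Cmod_ge_0 (it n s - it n t)%C); lra.
  - replace (theta (it n s)) with ((it n s + theta (it n s)) - it n s)%C by ring.
    rewrite E'; ring.
Qed.

Lemma escapes_of_char : (1 < c0)%nat -> escapes.
Proof.
  intros Hc s X Hs; unfold half_plane in Hs.
  assert (H1 : 1 < INR c0) by now apply (lt_INR 1).
  destruct (Pow_x_infinity (INR c0) ltac:(rewrite Rabs_pos_eq; lra) (Rabs X / Re s + 1))
    as [n Hn]; exists n; intros m Hm.
  eapply Rlt_le_trans; [|now apply Re_iter_ge].
  specialize (Hn m Hm); rewrite Rabs_pos_eq in Hn by (apply pow_le; lra).
  apply Rlt_le_trans with ((Rabs X / Re s + 1) * Re s).
  - replace ((Rabs X / Re s + 1) * Re s) with (Rabs X + Re s) by (field; lra).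
    pose proof (Rle_abs X); lra.
  - apply Rmult_le_compat_r; lra.
Qed.

(** For a drift with [Re (c 1) > 0], Harnack's inequality gives an escape at a linear speed
    that is uniform on half-planes. *)
Lemma Re_iter_drift eps :
  0 < eps -> 0 < Re (c 1%nat) ->
  exists kappa, 0 < kappa /\
    forall n s, half_plane eps s -> INR n * kappa <= Re (it n s).
Proof.
  intros He Hc1; destruct Hsym as (_ & _ & _ & Hc & Hpos).
  destruct (harnack_dirichlet c psi eps Hc Hpos He) as [nu [Hnu H]].
  exists (nu * Re (c 1%nat)); split; [nra|]; intros n s Hs.
  induction n as [|n IH].
  - simpl; unfold half_plane in Hs; lra.
  - pose proof (iter_half_plane n eps s ltac:(lra) Hs) as Hn.
    specialize (H _ Hn); unfold half_plane in Hn.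
    rewrite S_INR; simpl; rewrite Re_symbol by (unfold half_plane; fold (it n s); lra).
    fold (it n s); pose proof INR_char_ge_1; nra.
Qed.

Lemma escapes_of_drift : 0 < Re (c 1%nat) -> escapes.
Proof.
  intros Hc1 s X Hs; unfold half_plane in Hs.
  destruct (Re_iter_drift (Re s / 2) ltac:(lra) Hc1) as [kappa [Hk H]].
  destruct (INR_archimed kappa X Hk) as [n Hn].
  exists n; intros m Hm; eapply Rlt_le_trans; [|apply H; unfold half_plane; lra].
  apply le_INR in Hm; nra.
Qed.

(** * The Abel equation *)

Lemma drift_increment_geometric eps :
  0 < eps -> 0 < Re (c 1%nat) ->
  exists K q, 0 <= K /\ 0 <= q < 1 /\
    forall n s, half_plane eps s -> Cmod (psi (it n s) - c 1%nat)%C <= K * q ^ n.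
Proof.
  intros He Hc1; destruct (Re_iter_drift eps He Hc1) as [kappa [Hk Hit]].
  destruct (uapprox_bounded psi eps symbol_uapprox He) as [B2 [HB2 Hbd]].
  destruct Hsym as (_ & _ & _ & Hc & _).
  destruct (dirichlet_tail c psi (Hc (1 / 2) ltac:(lra))) as [B [HB HT]].
  pose proof ln_lt_2 as Hl2; pose proof (Cmod_ge_0 (c 1%nat)).
  set (D := B + B2 + Cmod (c 1%nat)).
  exists (D * exp (3 * ln 2)), (exp (- (kappa * ln 2))).
  pose proof (exp_pos (3 * ln 2)); pose proof (exp_pos (- (kappa * ln 2))).
  split; [apply Rmult_le_pos; unfold D; lra|]; split.
  { split; [lra|]; rewrite <- exp_0; apply exp_increasing; nra. }
  intros n s Hs; specialize (Hit n s Hs).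
  rewrite <- exp_INR_mult, Rmult_assoc, <- exp_plus.
  pose proof (exp_pos (3 * ln 2 + INR n * - (kappa * ln 2))) as HE.
  destruct (Rle_or_lt 3 (Re (it n s))) as [H3|H3].
  - specialize (HT 1%nat (it n s) (le_n _) H3).
    rewrite partial_constant in HT by (lia || (intros; lia)).
    eapply Rle_trans; [exact HT|].
    apply Rmult_le_compat; [assumption | left; apply exp_pos | unfold D; lra|].
    apply exp_le_exp; change (INR 2) with 2; nra.
  - (* only finitely many steps, on which [psi] is bounded *)
    assert (HE1 : 1 <= exp (3 * ln 2 + INR n * - (kappa * ln 2))).
    { rewrite <- exp_0 at 1; apply exp_le_exp; nra. }
    apply Rle_trans with D; [|unfold D in *; nra].
    unfold Cminus; eapply Rle_trans; [apply Cmod_triangle|]; rewrite Cmod_opp.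
    specialize (Hbd (it n s) (iter_half_plane n eps s ltac:(lra) Hs)); unfold D; lra.
Qed.

(** The limit of [phi^n(s) - n c_1]. *)
Lemma abel_solution :
  c0 = 1%nat -> 0 < Re (c 1%nat) ->
  exists theta, uapprox theta /\
    forall s, half_plane 0 s -> (phi s + theta (phi s))%C = (s + theta s + c 1%nat)%C.
Proof.
  intros Hchar Hc1.
  pose proof Hsym as (_ & Hphi & _).
  assert (Hphi1 : forall s, half_plane 0 s -> phi s = (s + psi s)%C).
  { intros s Hs; rewrite Hphi, Hchar by assumption; simpl; ring. }
  set (U := fun N s => (it N s - s - RtoC (INR N) * c 1%nat)%C).
  assert (HUS : forall N s, half_plane 0 s ->
    U (S N) s = (U N s + (psi (it N s) - c 1%nat))%C).
  { intros N s Hs; unfold U; rewrite S_INR, RtoC_plus.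
    replace (it (S N) s) with (it N s + psi (it N s))%C; [ring|].
    symmetry; apply Hphi1, iter_half_plane; [lra | assumption]. }
  destruct (uapprox_lim U) as [theta [Hth Hlim]].
  - induction N as [|N IH].
    + apply (uapprox_ext (fun _ => RtoC 0)); [|apply uapprox_const].
      intros s _; unfold U; simpl; ring.
    + apply (uapprox_ext (fun s => U N s + (psi (it N s) + - c 1%nat))%C);
        [intros s Hs; now rewrite HUS|].
      apply uapprox_plus; [exact IH|]; apply uapprox_plus; [|apply uapprox_const].
      apply uapprox_iter, symbol_uapprox.
  - intros eps He; destruct (drift_increment_geometric eps He Hc1) as [K [q [HK [Hq H]]]].
    exists K, q; do 2 (split; [assumption|]); intros N s Hs.
    rewrite HUS by (unfold half_plane in *; lra).
    replace (U N s + (psi (it N s) - c 1%nat) - U N s)%C with (psi (it N s) - c 1%nat)%C by ring.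
    now apply H.
  - exists theta; split; [assumption|]; intros s Hs.
    pose proof (iter_half_plane 1 0 s (Rle_refl _) Hs) as Hs1; simpl in Hs1.
    apply Cmod_eq_of_le; intros eta Heta.
    destruct (Hlim s Hs (eta / 2)) as [N1 HN1]; [lra|].
    destruct (Hlim (phi s) Hs1 (eta / 2)) as [N2 HN2]; [lra|].
    set (N := Nat.max N1 N2); specialize (HN1 (S N) ltac:(lia)); specialize (HN2 N ltac:(lia)).
    replace (phi s + theta (phi s) - (s + theta s + c 1%nat))%C
      with ((U (S N) s - theta s) + - (U N (phi s) - theta (phi s)))%C.
    + eapply Rle_trans; [apply Cmod_triangle|]; rewrite Cmod_opp; lra.
    + unfold U; rewrite iter_succ_r, S_INR, RtoC_plus; ring.
Qed.

Lemma abel_iterate theta :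
  (forall s, half_plane 0 s -> (phi s + theta (phi s))%C = (s + theta s + c 1%nat)%C) ->
  forall n, exists A B, forall s, half_plane 0 s ->
    (s + theta s)%C = (A * (it n s + theta (it n s)) + B)%C.
Proof.
  intros Heq n; exists (RtoC 1), (- (RtoC (INR n) * c 1%nat))%C; intros s Hs.
  induction n as [|n IH]; [simpl; ring|].
  change (it (S n) s) with (phi (it n s)).
  rewrite Heq by (apply iter_half_plane; [lra | assumption]).
  rewrite IH, S_INR, RtoC_plus; ring.
Qed.

(** Gives uniqueness up to a constant in the Abel equation, the difference of two solutions
    being invariant: along an orbit that goes to the right, [w] tends to its
    constant coefficient. *)
Lemma invariant_constant b w :
  (forall eps, 0 < eps -> dirichlet_cvg_unif b (half_plane eps) w) -> escapes ->
  (forall s, half_plane 0 s -> w (phi s) = w s) ->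
  forall s, half_plane 0 s -> w s = b 1%nat.
Proof.
  intros Hb Hesc Hinv s Hs; apply Cmod_eq_of_le; intros eta Heta.
  destruct (dirichlet_limit b w eta (Hb (1 / 2) ltac:(lra)) Heta) as [X [_ HX]].
  destruct (Hesc s X Hs) as [n Hn]; specialize (Hn n (le_n _)).
  replace (w s) with (w (it n s)); [now apply HX|].
  clear Hn; induction n as [|n IH]; [reflexivity|].
  change (it (S n) s) with (phi (it n s)).
  now rewrite Hinv by (apply iter_half_plane; [lra | assumption]).
Qed.

(** * The Schroeder equation *)

(** The limit of [phi^n(s) / c0^n]. The lower bound on the real part, which makes the
    solution a member of the class, comes from [Re phi^(n+1)(s) >= c0^n Re phi(s)]. *)
Lemma schroeder_solution :
  (1 < c0)%nat ->
  exists theta, uapprox theta /\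
    (forall s, half_plane 0 s -> Re (psi s) / INR c0 <= Re (theta s)) /\
    (forall s, half_plane 0 s ->
       (phi s + theta (phi s))%C = (RtoC (INR c0) * (s + theta s))%C).
Proof.
  intros Hc; pose proof Hsym as (_ & Hphi & _ & _ & Hpos).
  assert (H1 : 1 < INR c0) by now apply (lt_INR 1).
  set (k := RtoC (INR c0)); set (j := RtoC (/ INR c0)).
  assert (Hkj : (k * j)%C = RtoC 1).
  { unfold k, j; rewrite <- RtoC_mult, Rinv_r by lra; reflexivity. }
  set (U := fun N s => (j ^ N * it N s - s)%C).
  assert (HUS : forall N s, half_plane 0 s ->
    U (S N) s = (U N s + (j * j ^ N) * psi (it N s))%C).
  { intros N s Hs; unfold U; rewrite Cpow_S.
    replace (it (S N) s) with (k * it N s + psi (it N s))%C;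
      [|symmetry; apply Hphi, iter_half_plane; [lra | assumption]].
    replace (j * j ^ N * (k * it N s + psi (it N s)) - s)%C
      with (k * j * j ^ N * it N s - s + j * j ^ N * psi (it N s))%C by ring.
    rewrite Hkj; ring. }
  assert (Hinv : 0 < / INR c0 < 1).
  { split; [apply Rinv_0_lt_compat; lra|].
    rewrite <- Rinv_1; apply Rinv_lt_contravar; lra. }
  assert (Hj : forall N, (j ^ N)%C = RtoC ((/ INR c0) ^ N)) by (intros; symmetry; apply RtoC_pow).
  destruct (uapprox_lim U) as [theta [Hth Hlim]].
  - induction N as [|N IH].
    + apply (uapprox_ext (fun _ => RtoC 0)); [|apply uapprox_const].
      intros s _; unfold U; simpl; ring.
    + apply (uapprox_ext (fun s => U N s + (j * j ^ N) * psi (it N s))%C);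
        [intros s Hs; now rewrite HUS|].
      apply uapprox_plus; [exact IH|]; apply uapprox_scal, uapprox_iter, symbol_uapprox.
  - intros eps He; destruct (uapprox_bounded psi eps symbol_uapprox He) as [B [HB H]].
    exists B, (/ INR c0); split; [assumption|]; split; [lra|]; intros N s Hs.
    rewrite HUS by (unfold half_plane in *; lra).
    replace (U N s + j * j ^ N * psi (it N s) - U N s)%C
      with (j * j ^ N * psi (it N s))%C by ring.
    rewrite <- Cpow_S, Hj, Cmod_mult, Cmod_R, Rabs_pos_eq by (apply pow_le; lra).
    rewrite Rmult_comm; apply Rmult_le_compat; try apply Cmod_ge_0; [apply pow_le; lra | |].
    + apply H, iter_half_plane; [lra | assumption].
    + simpl; pose proof (pow_le (/ INR c0) N ltac:(lra)); nra.
  - exists theta; split; [assumption|]; split; intros s Hs;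
      pose proof (iter_half_plane 1 0 s (Rle_refl _) Hs) as Hs1; simpl in Hs1.
    + apply Rle_plus_epsilon; intros eta Heta.
      destruct (Hlim s Hs eta Heta) as [N HN]; specialize (HN (S N) ltac:(lia)).
      assert (HU : Re (psi s) / INR c0 <= Re (U (S N) s)).
      { unfold U, Cminus; rewrite re_plus, re_opp, Hj, re_scal_l, iter_succ_r.
        pose proof (Re_iter_ge N (phi s) Hs1) as HR; rewrite Re_symbol in HR by assumption.
        apply Rle_trans with ((/ INR c0) ^ S N *
          (INR c0 ^ N * (INR c0 * Re s + Re (psi s))) + - Re s).
        - right; rewrite !pow_inv; simpl; field; split; [apply pow_nonzero|]; lra.
        - apply Rplus_le_compat_r, Rmult_le_compat_l; [apply pow_le; lra | exact HR]. }
      pose proof (Re_le_Cmod (U (S N) s - theta s)%C) as HR.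
      unfold Cminus in HR, HN; rewrite re_plus, re_opp in HR; lra.
    + apply Cmod_eq_of_le; intros eta Heta.
      destruct (Hlim s Hs (eta / 2 / INR c0)) as [N1 HN1]; [repeat apply Rdiv_lt_0_compat; lra|].
      destruct (Hlim (phi s) Hs1 (eta / 2)) as [N2 HN2]; [lra|].
      set (N := Nat.max N1 N2); specialize (HN1 (S N) ltac:(lia)); specialize (HN2 N ltac:(lia)).
      replace (phi s + theta (phi s) - k * (s + theta s))%C
        with (k * (U (S N) s - theta s) + - (U N (phi s) - theta (phi s)))%C.
      * eapply Rle_trans; [apply Cmod_triangle|]; rewrite Cmod_opp, Cmod_mult.
        unfold k at 1; rewrite Cmod_R, Rabs_pos_eq by lra.
        apply (Rmult_le_compat_l (INR c0)) in HN1; [|lra].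
        replace (INR c0 * (eta / 2 / INR c0)) with (eta / 2) in HN1 by (field; lra); lra.
      * unfold U; rewrite iter_succ_r, Cpow_S.
        replace (k * (j * j ^ N * it N (phi s) - s - theta s))%C
          with (k * j * (j ^ N * it N (phi s)) - k * s - k * theta s)%C by ring.
        rewrite Hkj; ring.
Qed.

Lemma schroeder_iterate theta :
  (forall s, half_plane 0 s ->
     (phi s + theta (phi s))%C = (RtoC (INR c0) * (s + theta s))%C) ->
  forall n, exists A B, forall s, half_plane 0 s ->
    (s + theta s)%C = (A * (it n s + theta (it n s)) + B)%C.
Proof.
  intros Heq n; exists (RtoC (/ INR c0) ^ n)%C, (RtoC 0); intros s Hs.
  pose proof INR_char_ge_1.
  induction n as [|n IH]; [simpl; ring|].
  change (it (S n) s) with (phi (it n s)).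
  rewrite Heq by (apply iter_half_plane; [lra | assumption]).
  rewrite IH, Cpow_S.
  transitivity (RtoC (/ INR c0) * RtoC (INR c0)
    * RtoC (/ INR c0) ^ n * (it n s + theta (it n s)) + 0)%C; [|ring].
  rewrite <- RtoC_mult, Rinv_l by lra; ring.
Qed.

(** Along an orbit, [w] is multiplied by [c0] at each step but remains bounded. *)
Lemma schroeder_kernel w :
  (1 < c0)%nat -> uapprox w ->
  (forall s, half_plane 0 s -> w (phi s) = (RtoC (INR c0) * w s)%C) ->
  forall s, half_plane 0 s -> w s = RtoC 0.
Proof.
  intros Hc Hw Heq s Hs.
  assert (H1 : 1 < INR c0) by now apply (lt_INR 1).
  assert (Hn : forall n, Cmod (w (it n s)) = INR c0 ^ n * Cmod (w s)).
  { induction n as [|n IH]; [simpl; ring|].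
    change (it (S n) s) with (phi (it n s)).
    rewrite Heq by (apply iter_half_plane; [lra | assumption]).
    rewrite Cmod_mult, Cmod_R, Rabs_pos_eq, IH by lra; simpl; ring. }
  unfold half_plane in Hs.
  destruct (uapprox_bounded w (Re s / 2) Hw ltac:(lra)) as [B [HB Hbd]].
  apply Cmod_eq_0, Rle_antisym; [|apply Cmod_ge_0].
  apply Rnot_lt_le; intros Hpos.
  destruct (Pow_x_infinity (INR c0) ltac:(rewrite Rabs_pos_eq; lra) ((B + 1) / Cmod (w s)))
    as [n HN]; specialize (HN n (le_n _)).
  rewrite Rabs_pos_eq in HN by (apply pow_le; lra).
  specialize (Hbd (it n s) (iter_half_plane n (Re s / 2) s ltac:(lra) ltac:(unfold half_plane; lra))).
  rewrite Hn in Hbd.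
  apply Rge_le, (Rmult_le_compat_r (Cmod (w s))) in HN; [|lra].
  replace ((B + 1) / Cmod (w s) * Cmod (w s)) with (B + 1) in HN by (field; lra); lra.
Qed.

End Iteration.

(** * The linearization theorem *)

Lemma class_GH_pos_intro a theta :
  (forall eps, 0 < eps -> dirichlet_cvg_unif a (half_plane eps) theta) ->
  holomorphic_on (half_plane 0) theta ->
  class_GH_pos 1 (fun s => s + theta s)%C.
Proof.
  intros Ha Hhol; split; [lia|]; split.
  - apply (holomorphic_ext (fun s => (1 * s + 0) + theta s)%C); [intros; ring|].
    intros s Hs; apply C_derivable_plus; [apply C_derivable_affine | now apply Hhol].
  - exists a, theta; split; [|assumption]; intros s _; simpl; ring.
Qed.

Lemma class_G_pos_intro a theta :
  (forall eps, 0 < eps -> dirichlet_cvg_unif a (half_plane eps) theta) ->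
  holomorphic_on (half_plane 0) theta ->
  (exists tau : R, forall s, half_plane 0 s -> theta s = (Ci * RtoC tau)%C)
    \/ maps_into (half_plane 0) (half_plane 0) theta ->
  class_G_pos 1 (fun s => s + theta s)%C.
Proof.
  intros Ha Hhol Halt; split; [lia|]; exists a, theta; repeat split; try assumption.
  - intros s Hs; unfold half_plane in *; rewrite re_plus.
    destruct Halt as [[tau Ht] | Hm].
    + rewrite Ht by (unfold half_plane; lra); simpl; lra.
    + specialize (Hm s ltac:(unfold half_plane; lra)); unfold half_plane in Hm; lra.
  - intros s _; simpl; ring.
  - apply open_half_plane.
  - exists 0; intros s Hs; exact Hs.
  - exists 0; intros s Hs; unfold half_plane in Hs.
    unfold is_dirichlet_series, is_series.
    apply (filterlim_locally (U := C_UniformSpace)); intros e.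
    destruct (Ha (Re s / 2) ltac:(lra) e (cond_pos e)) as [N0 HN0].
    exists N0; intros N HN; apply C_NormedModule_mixin_compat1.
    change (Cmod (@sum_n C_AbelianMonoid (fun n => dirichlet_term a s (S n)) N - theta s)%C < e).
    unfold sum_n; rewrite (sum_n_m_S (dirichlet_term a s)).
    apply (HN0 (S N)); [lia | unfold half_plane; lra].
  - intros H0; discriminate H0.
  - intros _; assumption.
Qed.

Lemma imaginary_constant_coef c psi tau :
  dirichlet_cvg_unif c (half_plane (1 / 2)) psi ->
  (forall s, half_plane 0 s -> psi s = (Ci * RtoC tau)%C) ->
  c 1%nat = (Ci * RtoC tau)%C.
Proof.
  intros Hc Ht; symmetry; apply Cmod_eq_of_le; intros eta Heta.
  destruct (dirichlet_limit c psi eta Hc Heta) as [X [HX H]].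
  specialize (H (RtoC (X + 1))); rewrite re_RtoC in H.
  rewrite <- (Ht (RtoC (X + 1))) by (unfold half_plane; rewrite re_RtoC; lra).
  apply H; lra.
Qed.

(** Comparing the leading nonconstant terms of [w (s + i tau)] and of [w s] kills the
    coefficients one after the other. *)
Lemma translation_invariant_constant b w tau :
  (forall eps, 0 < eps -> dirichlet_cvg_unif b (half_plane eps) w) ->
  (forall s, half_plane 0 s -> w (s + Ci * RtoC tau)%C = w s) ->
  (forall n, (2 <= n)%nat -> npow_opp n (Ci * RtoC tau)%C <> RtoC 1) ->
  forall s, half_plane 0 s -> w s = b 1%nat.
Proof.
  intros Hb Hinv Hres; enough (Hzero : forall k, (2 <= k)%nat -> b k = RtoC 0)
    by (intros s; now apply dirichlet_constant).
  intros k; induction k as [k IH] using (well_founded_induction Wf_nat.lt_wf); intros Hk.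
  set (z := (npow_opp k (Ci * RtoC tau) - 1)%C).
  assert (Hz : (b k * z)%C = RtoC 0).
  { apply Cmod_eq_of_le; intros eta Heta.
    destruct (dirichlet_leading b w k (eta / 2) (Hb (1 / 2) ltac:(lra)) Hk) as [X [HX3 HX]];
      [intros; apply IH; lia | lra|].
    set (s := RtoC (X + 1)); set (s' := (s + Ci * RtoC tau)%C).
    assert (Hs : Re s = X + 1) by apply re_RtoC.
    assert (Hs' : Re s' = X + 1) by (unfold s', s; simpl; ring).
    pose proof (HX s ltac:(lra)) as E1; pose proof (HX s' ltac:(lra)) as E2.
    unfold s' in E2 at 1; rewrite Hinv in E2 by (unfold half_plane; lra).
    assert (Hn : Cmod (npow_opp k s') = Cmod (npow_opp k s))
      by (rewrite !Cmod_npow, Hs, Hs'; reflexivity).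
    rewrite Hn in E2; set (m := Cmod (npow_opp k s)) in *.
    assert (Hm : 0 < m) by (unfold m; rewrite Cmod_npow; apply exp_pos).
    apply Rmult_le_reg_r with m; [assumption|]; unfold m at 1; rewrite <- Cmod_mult.
    match type of E1 with Cmod ?u <= _ => match type of E2 with Cmod ?v <= _ =>
      replace ((b k * z - 0) * npow_opp k s)%C with (u + - v)%C end end.
    - eapply Rle_trans; [apply Cmod_triangle|]; rewrite Cmod_opp; lra.
    - unfold z, s'; rewrite npow_plus; ring. }
  destruct (Ceq_dec (b k) (RtoC 0)) as [E|E]; [exact E|].
  exfalso; apply (Hres k Hk).
  replace (npow_opp k (Ci * RtoC tau)) with (z + 1)%C by (unfold z; ring).
  replace z with (/ b k * (b k * z))%C by (field; exact E).
  rewrite Hz; ring.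
Qed.

Theorem theorem1p1 (c0 : nat) (c : nat -> C) (psi phi : C -> C)
  (hc0 : (1 <= c0)%nat) (hphi : gordon_hedenmalm c0 c psi phi) :
  (c0 = 1%nat ->
     (exists u : C -> C,
        class_GH_pos 1 u /\ abel_equation phi (c 1%nat) u /\
        (injective_on (half_plane 0) phi -> injective_on (half_plane 0) u)) /\
     (~ resonant_translation psi ->
      forall u v : C -> C,
        class_GH_pos 1 u -> abel_equation phi (c 1%nat) u ->
        class_GH_pos 1 v -> abel_equation phi (c 1%nat) v ->
        exists b : C, forall s : C, half_plane 0 s -> v s = (u s + b)%C) /\
     ((exists delta : R, 0 < delta /\
         maps_into (half_plane 0) (half_plane delta) phi) ->
      exists u : C -> C,
        class_G_pos 1 u /\ abel_equation phi (c 1%nat) u /\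
        (injective_on (half_plane 0) phi -> injective_on (half_plane 0) u)))
  /\
  ((1 < c0)%nat ->
     exists u : C -> C,
       class_G_pos 1 u /\ schroeder_equation phi (RtoC (INR c0)) u /\
       (forall v : C -> C,
          class_G_pos 1 v -> schroeder_equation phi (RtoC (INR c0)) v ->
          forall s : C, half_plane 0 s -> v s = u s) /\
       (injective_on (half_plane 0) phi -> injective_on (half_plane 0) u)).
Proof.
  pose proof (gordon_hedenmalm_symbol c0 c psi phi hc0 hphi) as Hsym.
  pose proof Hsym as (_ & Hphi & _ & Hc & Hpos).
  assert (Halt : (exists tau : R, forall s, half_plane 0 s -> psi s = (Ci * RtoC tau)%C)
                 \/ maps_into (half_plane 0) (half_plane 0) psi)
    by now apply hphi.
  assert (Hphi0 : forall s, half_plane 0 s -> half_plane 0 (phi s))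
    by (intros s; apply (iter_half_plane c0 c psi phi Hsym 1 0 s), Rle_refl).
  split.
  - intros Hc1.
    assert (Hphi1 : forall s, half_plane 0 s -> phi s = (s + psi s)%C)
      by (intros s Hs; rewrite Hphi, Hc1 by assumption; simpl; ring).
    split; [|split].
    + destruct Halt as [[tau Ht] | Hm].
      * exists (fun s => s + (fun _ => RtoC 0) s)%C; split; [|split].
        -- destruct (uapprox_cvg _ (uapprox_const (RtoC 0))) as [a Ha].
           apply (class_GH_pos_intro a (fun _ => RtoC 0) Ha).
           apply (holomorphic_ext (fun s => 0 * s + 0)%C); [intros; ring|].
           intros s _; apply C_derivable_affine.
        -- intros s Hs; rewrite Hphi1, Ht by assumption.
           rewrite (imaginary_constant_coef c psi tau (Hc (1 / 2) ltac:(lra)) Ht); ring.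
        -- intros _ s t _ _ E; rewrite !Cplus_0_r in E; exact E.
      * pose proof (constant_coef_positive c psi Hc Hm) as Hdrift.
        pose proof (escapes_of_drift c0 c psi phi Hsym Hdrift) as Hesc.
        destruct (abel_solution c0 c psi phi Hsym Hc1 Hdrift) as [theta [Hth Heq]].
        destruct (uapprox_cvg theta Hth) as [a Ha].
        exists (fun s => s + theta s)%C; split; [|split].
        -- apply (class_GH_pos_intro a theta Ha).
           apply (linearizer_holomorphic c0 c psi phi Hsym a theta Ha Hesc).
           now apply (abel_iterate c0 c psi phi Hsym).
        -- exact Heq.
        -- now apply (linearizer_injective c0 c psi phi Hsym a theta
             (fun z => z + c 1%nat)%C).
    + intros Hres u v [_ [_ [a [th [Hu Ha]]]]] Hau [_ [_ [a' [th' [Hv Ha']]]]] Hav.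
      set (b := fun n => (a' n - a n)%C); set (w := fun s => (th' s - th s)%C).
      assert (Hb : forall eps, 0 < eps -> dirichlet_cvg_unif b (half_plane eps) w)
        by (intros eps He; apply cvg_unif_minus; auto).
      assert (Hw : forall s, half_plane 0 s -> v s = (u s + w s)%C)
        by (intros s Hs; rewrite Hu, Hv by assumption; unfold w; ring).
      assert (Hinv : forall s, half_plane 0 s -> w (phi s) = w s).
      { intros s Hs.
        replace (w (phi s)) with (v (phi s) - u (phi s))%C
          by (rewrite Hw by auto; ring).
        rewrite Hau, Hav, Hw by assumption; ring. }
      exists (b 1%nat); intros s Hs; rewrite Hw by assumption; f_equal.
      destruct Halt as [[tau Ht] | Hm].
      * apply (translation_invariant_constant b w tau); try assumption.
        -- intros z Hz; rewrite <- (Ht z Hz), <- Hphi1 by assumption; now apply Hinv.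
        -- intros n Hn E; apply Hres; now exists tau, n.
      * pose proof (constant_coef_positive c psi Hc Hm) as Hdrift.
        apply (invariant_constant c0 c psi phi Hsym b w); try assumption.
        now apply (escapes_of_drift c0 c psi phi Hsym).
    + intros [delta [Hdelta Hmaps]].
      assert (Hm : maps_into (half_plane 0) (half_plane 0) psi).
      { destruct Halt as [[tau Ht] | Hm]; [|exact Hm]; exfalso.
        assert (Hd : half_plane 0 (RtoC (delta / 2)))
          by (unfold half_plane; rewrite re_RtoC; lra).
        specialize (Hmaps _ Hd); rewrite Hphi1, Ht in Hmaps by assumption.
        unfold half_plane in Hmaps; simpl in Hmaps; lra. }
      pose proof (constant_coef_positive c psi Hc Hm) as Hdrift.
      pose proof (escapes_of_drift c0 c psi phi Hsym Hdrift) as Hesc.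
      destruct (abel_solution c0 c psi phi Hsym Hc1 Hdrift) as [theta0 [Hth0 Heq0]].
      (* [theta0 s = psi s - c 1 + theta0 (phi s)] is bounded below in real part, since
         [theta0] is bounded on [Re s > delta] *)
      destruct (uapprox_bounded theta0 delta Hth0 Hdelta) as [B [HB Hbd]].
      set (k := Cmod (c 1%nat) + B + 1).
      set (theta := fun s => (theta0 s + RtoC k)%C).
      assert (Heq : forall s, half_plane 0 s ->
        (phi s + theta (phi s))%C = (s + theta s + c 1%nat)%C).
      { intros s Hs; unfold theta; rewrite !Cplus_assoc, Heq0 by assumption; ring. }
      destruct (uapprox_cvg theta) as [a Ha];
        [apply uapprox_plus; [assumption | apply uapprox_const]|].
      exists (fun s => s + theta s)%C; split; [|split].
      * apply (class_G_pos_intro a theta Ha).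
        -- apply (linearizer_holomorphic c0 c psi phi Hsym a theta Ha Hesc).
           now apply (abel_iterate c0 c psi phi Hsym).
        -- right; intros s Hs; unfold half_plane, theta; rewrite re_plus, re_RtoC.
           replace (theta0 s) with (psi s + - c 1%nat + theta0 (phi s))%C.
           ++ rewrite !re_plus, re_opp; specialize (Hbd (phi s) (Hmaps s Hs)).
              specialize (Hm s Hs); unfold half_plane in Hm.
              pose proof (Re_ge_Cmod (theta0 (phi s))); pose proof (Re_le_Cmod (c 1%nat)).
              unfold k; lra.
           ++ specialize (Heq0 s Hs); rewrite (Hphi1 s Hs) in Heq0 at 1.
              replace (theta0 s) with (s + theta0 s + c 1%nat - s - c 1%nat)%C by ring.
              rewrite <- Heq0; ring.
      * exact Heq.
      * now apply (linearizer_injective c0 c psi phi Hsym a theta (fun z => z + c 1%nat)%C).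
  - intros Hchar; pose proof (escapes_of_char c0 c psi phi Hsym Hchar) as Hesc.
    assert (Hc1 : 1 < INR c0) by now apply (lt_INR 1).
    destruct (schroeder_solution c0 c psi phi Hsym Hchar) as [theta [Hth [Hlow Heq]]].
    destruct (uapprox_cvg theta Hth) as [a Ha].
    exists (fun s => s + theta s)%C; split; [|split; [exact Heq | split]].
    + apply (class_G_pos_intro a theta Ha).
      * apply (linearizer_holomorphic c0 c psi phi Hsym a theta Ha Hesc).
        now apply (schroeder_iterate c0 c psi phi Hsym).
      * destruct Halt as [[tau Ht] | Hm]; [left | right].
        -- (* here [s + i tau / (c0 - 1)] solves the equation, so [theta] is this constant *)
           exists (tau / (INR c0 - 1)); intros s Hs.
           set (l := (Ci * RtoC (tau / (INR c0 - 1)))%C).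
           replace (theta s) with ((theta s + - l) + l)%C by ring.
           rewrite (schroeder_kernel c0 c psi phi Hsym (fun s => theta s + - l)%C);
             [ring | assumption | | | assumption].
           ++ apply uapprox_plus; [assumption | apply uapprox_const].
           ++ intros z Hz; specialize (Heq z Hz).
              assert (Hl : (Ci * RtoC tau)%C = (RtoC (INR c0) * l - l)%C).
              { unfold l; transitivity (Ci * (RtoC ((INR c0 - 1) * (tau / (INR c0 - 1)))))%C.
                - do 2 f_equal; field; lra.
                - rewrite RtoC_mult, RtoC_minus; ring. }
              replace (theta (phi z)) with (phi z + theta (phi z) - phi z)%C by ring.
              rewrite Heq, Hphi, Ht, Hl by assumption; ring.
        -- intros s Hs; unfold half_plane; eapply Rlt_le_trans; [|now apply Hlow].
           apply Rdiv_lt_0_compat; [now apply Hm | lra].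
    + intros v [_ [a' [th' (_ & Hv & _ & Ha' & _)]]] Heqv s Hs.
      rewrite Hv by assumption.
      replace (th' s) with (theta s + (th' s + - (1) * theta s))%C by ring.
      rewrite (schroeder_kernel c0 c psi phi Hsym (fun s => th' s + - (1) * theta s)%C);
        [simpl; ring | assumption | | | assumption].
      * apply uapprox_plus; [now apply (uapprox_of_cvg a') | now apply uapprox_scal].
      * intros z Hz; specialize (Heqv z Hz); specialize (Heq z Hz).
        rewrite !Hv in Heqv by auto; simpl in Heqv.
        replace (th' (phi z)) with (1 * phi z + th' (phi z) - phi z)%C by ring.
        replace (theta (phi z)) with (phi z + theta (phi z) - phi z)%C by ring.
        rewrite Heqv, Heq; ring.
    + now apply (linearizer_injective c0 c psi phi Hsym a theta
        (fun z => RtoC (INR c0) * z)%C).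
Qed.
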